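(* Let $\mathbb{F}$ be $\mathbb{R}$, $\mathbb{C}$ or $\mathbb{H}$ (the quaternions), let $V$ be an affine real algebraic variety, let $X\subset V$ be a constructible closed subset, let $n$ be a nonnegative integer, and let $\xi=(E,p,X)$, where $E\subset X\times\mathbb{F}^n$, $p$ is the restriction of the projection $X\times\mathbb{F}^n\to X$, and each fiber $E_x=p^{-1}(x)$ is an $\mathbb{F}$-vector subspace of $\{x\}\times\mathbb{F}^n$. Then $\xi$ is a regulous $\mathbb{F}$-vector subbundle of $\varepsilon_X^n(\mathbb{F})$ if and only if $\xi$ is a topological (in the Euclidean topology) $\mathbb{F}$-vector subbundle of $\varepsilon_X^n(\mathbb{F})$ and there exists a stratification $\mathcal{S}$ of $X$ such that for every stratum $S\in\mathcal{S}$ the restriction $\xi|_S$ is an algebraic $\mathbb{F}$-vector subbundle of $\varepsilon_S^n(\mathbb{F})$ (that is, $\xi$ is a stratified-algebraic $\mathbb{F}$-vector bundle on $X$).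
   Context: Real algebraic background. An affine real algebraic variety is a locally ringed space isomorphic to an algebraic subset of some $\mathbb{R}^m$ with the Zariski topology and the sheaf of real-valued regular functions; it also carries the Euclidean topology. Zariski locally closed subsets of affine real algebraic varieties are themselves affine real algebraic varieties. A subset of $V$ is constructible if it is a finite union of Zariski locally closed subsets. A stratification of a constructible set $A\subset V$ is a finite collection of pairwise disjoint Zariski locally closed subsets of $V$ (strata) with union $A$. A map $A\to W$ into an affine real algebraic variety $W$ is regulous if it is continuous in the Euclidean topology and there is a stratification of $A$ such that its restriction to each stratum is a regular map. The constructible topology on $V$ has as closed sets the Euclidean closed constructible subsets; subsets carry the induced topology; ''constructible closed'' means closed in this topology. Regulous varieties. A constructible closed subset $A$ of an affine real algebraic variety, with the constructible topology and the sheaf $\mathcal{R}^0_A$ of regulous real-valued functions on its open subsets, is an affine regulous variety (as is anything isomorphic to it); a regulous variety is a locally ringed space with a finite open cover by affine regulous varieties; regulous maps of regulous varieties are morphisms of locally ringed spaces. Locally closed subsets with the restricted sheaf are regulous varieties; $X\times\mathbb{F}^n$ is regarded as a constructible closed subset of $V\times\mathbb{F}^n$, with $\mathbb{F}^n$ identified with $\mathbb{R}^{n\dim_{\mathbb{R}}\mathbb{F}}$. Bundles ($\mathbb{F}$-vector spaces are left vector spaces). $\varepsilon^n_X(\mathbb{F})$ is the product bundle $X\times\mathbb{F}^n\to X$. The triple $\xi$ is a regulous $\mathbb{F}$-vector subbundle of $\varepsilon_X^n(\mathbb{F})$ if $E$ is closed in $X\times\mathbb{F}^n$ in the constructible topology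 and every $x\in X$ has a neighborhood $U\subset X$ open in the constructible topology with a regulous isomorphism $p^{-1}(U)\to U\times\mathbb{F}^r$ (some $r\ge0$) restricting to $\mathbb{F}$-linear isomorphisms $E_y\to\{y\}\times\mathbb{F}^r$, $y\in U$. It is a topological $\mathbb{F}$-vector subbundle if it is locally trivial in the same sense with Euclidean open neighborhoods and homeomorphisms. For an affine real algebraic variety $S$, a family of vector subspaces with total space $E\subset S\times\mathbb{F}^n$ is an algebraic $\mathbb{F}$-vector subbundle of $\varepsilon^n_S(\mathbb{F})$ if $E$ is Zariski closed in $S\times\mathbb{F}^n$ and it is locally trivial in the same sense with Zariski open neighborhoods and biregular isomorphisms. *)

(* Defs.v *)
From HB Require Import structures.
From mathcomp Require Import all_boot all_order all_algebra.
From mathcomp Require Import ring complex.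
From mathcomp Require Import all_classical all_reals all_analysis.
(* Not imported: the notations of mpoly and of mathcomp-analysis clash. *)
From mathcomp Require mpoly.

Set Implicit Arguments.
Unset Strict Implicit.
Unset Printing Implicit Defensive.

Import Order.TTheory GRing.Theory Num.Theory.
Import numFieldNormedType.Exports.

Local Open Scope classical_set_scope.
Local Open Scope ring_scope.

(* Hamilton's quaternions a + b i + c j + d k *)

Record quaternion (R : Type) := Quaternion { qre : R; qi : R; qj : R; qk : R }.

Section QuaternionRing.
Variable R : realType.
Local Notation H := (quaternion R).

Definition quat_tuple (x : H) := (qre x, qi x, qj x, qk x).
Definition tuple_quat (t : R * R * R * R) : H :=
  let: (a, b, c, d) := t in Quaternion a b c d.
Lemma quat_tupleK : cancel quat_tuple tuple_quat. Proof. by case. Qed.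

HB.instance Definition _ := Equality.copy H (can_type quat_tupleK).
HB.instance Definition _ := Choice.copy H (can_type quat_tupleK).

Definition quat_zero : H := Quaternion 0 0 0 0.
Definition quat_one : H := Quaternion 1 0 0 0.
Definition quat_opp (x : H) : H :=
  Quaternion (- qre x) (- qi x) (- qj x) (- qk x).
Definition quat_add (x y : H) : H :=
  Quaternion (qre x + qre y) (qi x + qi y) (qj x + qj y) (qk x + qk y).
Definition quat_mul (x y : H) : H :=
  Quaternion
    (qre x * qre y - qi x * qi y - qj x * qj y - qk x * qk y)
    (qre x * qi y + qi x * qre y + qj x * qk y - qk x * qj y)
    (qre x * qj y - qi x * qk y + qj x * qre y + qk x * qi y)
    (qre x * qk y + qi x * qj y - qj x * qi y + qk x * qre y).

Lemma quat_addA : associative quat_add.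
Proof. by move=> x y z; rewrite /quat_add /= !addrA. Qed.
Lemma quat_addC : commutative quat_add.
Proof. by move=> x y; congr Quaternion; rewrite addrC. Qed.
Lemma quat_add0 : left_id quat_zero quat_add.
Proof. by case=> a b c d; rewrite /quat_add /= !add0r. Qed.
Lemma quat_addN : left_inverse quat_zero quat_opp quat_add.
Proof. by move=> x; rewrite /quat_add /= !addNr. Qed.
HB.instance Definition _ :=
  GRing.isZmodule.Build H quat_addA quat_addC quat_add0 quat_addN.

Lemma quat_mulA : associative quat_mul.
Proof. by move=> x y z; rewrite /quat_mul /=; congr Quaternion; ring. Qed.
Lemma quat_mul1l : left_id quat_one quat_mul.
Proof. by case=> a b c d; rewrite /quat_mul /=; congr Quaternion; ring. Qed.
Lemma quat_mul1r : right_id quat_one quat_mul.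
Proof. by case=> a b c d; rewrite /quat_mul /=; congr Quaternion; ring. Qed.
Lemma quat_mulDl : left_distributive quat_mul quat_add.
Proof. by move=> x y z; rewrite /quat_mul /=; congr Quaternion => /=; ring. Qed.
Lemma quat_mulDr : right_distributive quat_mul quat_add.
Proof. by move=> x y z; rewrite /quat_mul /=; congr Quaternion => /=; ring. Qed.
Lemma quat_one_neq0 : quat_one != 0.
Proof. by apply/eqP => -[] /eqP; rewrite oner_eq0. Qed.
HB.instance Definition _ := GRing.Zmodule_isNzRing.Build H
  quat_mulA quat_mul1l quat_mul1r quat_mulDl quat_mulDr quat_one_neq0.

End QuaternionRing.

Inductive scalar_kind := RealScalars | ComplexScalars | QuaternionScalars.

Definition scalar_ring (R : realType) (F : scalar_kind) : nzRingType :=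
  match F with
  | RealScalars => R
  | ComplexScalars => R[i]%C
  | QuaternionScalars => quaternion R
  end.

Definition real_dim (F : scalar_kind) : nat :=
  match F with
  | RealScalars => 1
  | ComplexScalars => 2
  | QuaternionScalars => 4
  end.

Definition scalar_coords (R : realType) (F : scalar_kind) :
    scalar_ring R F -> seq R :=
  match F with
  | RealScalars => fun x => [:: x]
  | ComplexScalars => fun z => [:: complex.Re z; complex.Im z]
  | QuaternionScalars => fun q => [:: qre q; qi q; qj q; qk q]
  end.

(* The identification of F^n with R^(n dim_R F). *)
Definition real_coords (R : realType) (F : scalar_kind) (n : nat)
    (w : 'rV[scalar_ring R F]_n) : 'rV[R]_(n * real_dim F) :=
  mxvec (\matrix_(i < n, j < real_dim F) (scalar_coords (w 0 i))`_j).

Definition scalar_of_coords (R : realType) (F : scalar_kind) :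
    (nat -> R) -> scalar_ring R F :=
  match F with
  | RealScalars => fun c => c 0%N
  | ComplexScalars => fun c => complex.Complex (c 0%N) (c 1%N)
  | QuaternionScalars =>
      fun c => Quaternion (c 0%N) (c 1%N) (c 2%N) (c 3%N)
  end.

Lemma scalar_coordsK (R : realType) (F : scalar_kind) (z : scalar_ring R F) :
  scalar_of_coords F (nth 0 (scalar_coords z)) = z.
Proof. by case: F z => //= -[]. Qed.

Lemma scalar_of_coordsK (R : realType) (F : scalar_kind) (c : nat -> R)
    (j : nat) :
  (j < real_dim F)%N -> (scalar_coords (scalar_of_coords F c))`_j = c j.
Proof. by case: F => //=; case: j => [|[|[|[|]]]]. Qed.

Lemma size_scalar_coords (R : realType) (F : scalar_kind) (z : scalar_ring R F) :
  size (scalar_coords z) = real_dim F.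
Proof. by case: F z. Qed.

Lemma real_coords_inj (R : realType) (F : scalar_kind) (n : nat) :
  injective (@real_coords R F n).
Proof.
move=> u v /(can_inj mxvecK)/matrixP uv; apply/rowP => i.
rewrite -[LHS]scalar_coordsK -[RHS]scalar_coordsK.
congr (scalar_of_coords F (nth 0 _)).
apply: (@eq_from_nth _ 0); first by rewrite !size_scalar_coords.
move=> j; rewrite size_scalar_coords => jF.
by have := uv i (Ordinal jF); rewrite !mxE.
Qed.

Lemma real_coords_surj (R : realType) (F : scalar_kind) (n : nat)
    (z : 'rV[R]_(n * real_dim F)) : exists w, real_coords (F := F) w = z.
Proof.
pose c i k : R := if insub k is Some j then vec_mx z i j
              else 0.
exists (\row_i scalar_of_coords F (c i)).
rewrite -[RHS]vec_mxK; congr mxvec; apply/matrixP => i j.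
by rewrite !mxE scalar_of_coordsK // /c valK mxE.
Qed.

(* Affine real algebraic varieties *)

Definition peval (R : realType) (m : nat) (p : mpoly.mpoly m R)
    (x : 'rV[R]_m) : R :=
  mpoly.meval (fun i => x 0 i) p.

Definition algebraic_set (R : realType) (m : nat) (Z : set 'rV[R]_m) : Prop :=
  exists P : set (mpoly.mpoly m R),
    Z = [set x | forall p, P p -> peval p x = 0].

(* A locally ringed space isomorphic to an algebraic subset of R^m is the same
   thing as a set together with a bijection [av_emb] onto such a subset: its
   Zariski topology, its sheaf of regular functions and its Euclidean topology,
   all defined below, are those of the algebraic subset transported along
   [av_emb], and an isomorphism of varieties preserves all three. *)
Record affineVariety (R : realType) := AffineVariety {
  av_carrier :> choiceType;
  av_dim : nat;
  av_emb : av_carrier -> 'rV[R]_av_dim;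
  av_emb_inj : injective av_emb;
  av_emb_alg : algebraic_set (range av_emb)
}.

Section ProductVariety.
Variables (R : realType) (V : affineVariety R) (F : scalar_kind) (n : nat).

Definition prod_emb (z : V * 'rV[scalar_ring R F]_n) :
    'rV[R]_(av_dim V + n * real_dim F) :=
  row_mx (av_emb z.1) (real_coords z.2).

Lemma prod_emb_inj : injective prod_emb.
Proof.
by move=> [x u] [y v] /eq_row_mx[/= /av_emb_inj-> /real_coords_inj->].
Qed.

Lemma prod_emb_alg : algebraic_set (range prod_emb).
Proof.
have [P VP] := av_emb_alg V.
pose lft (p : mpoly.mpoly (av_dim V) R) :
    mpoly.mpoly (av_dim V + n * real_dim F) R :=
  mpoly.comp_mpoly
    [tuple mpoly.mpolyX R (mpoly.mnm1 (lshift (n * real_dim F) i)) | i < _] p.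
have lftE p x : peval (lft p) x = peval p (lsubmx x).
  rewrite /peval /lft mpoly.comp_mpoly_meval; apply: mpoly.meval_eq => i.
  by rewrite tnth_mktuple mpoly.mevalXU mxE.
exists (lft @` P); apply/seteqP; split=> [_ [[x w] _ <-] _ [p Pp <-]|x xP].
  rewrite lftE /prod_emb /= row_mxKl.
  have : range (@av_emb _ V) (av_emb x) by exists x.
  by rewrite VP; apply.
have : range (@av_emb _ V) (lsubmx x).
  by rewrite VP => p Pp; rewrite -lftE; apply: xP; exists p.
case=> v _ vx; have [w wx] := real_coords_surj (F := F) (rsubmx x).
by exists (v, w) => //; rewrite /prod_emb /= vx wx hsubmxK.
Qed.

(* V x F^n *)
Definition prod_variety : affineVariety R :=
  @AffineVariety R (V * 'rV[scalar_ring R F]_n)%type _ prod_emb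
    prod_emb_inj prod_emb_alg.

End ProductVariety.

Section Topologies.
Variables (R : realType) (V : affineVariety R).
Implicit Types (A B C O S U : set V) (f : V -> R).

Definition zariski_closed C : Prop :=
  exists P : set (mpoly.mpoly (av_dim V) R),
    C = [set x | forall p, P p -> peval p (av_emb x) = 0].
Definition zariski_open O : Prop := zariski_closed (~` O).

(* V with the Euclidean topology *)
Definition euclidean : topologicalType := initial_topology (@av_emb R V).
Definition euclidean_open O : Prop := open (O : set euclidean).
Definition euclidean_closed C : Prop := closed (C : set euclidean).

Definition zariski_locally_closed A : Prop :=
  exists C O, [/\ zariski_closed C, zariski_open O & A = C `&` O].

Definition constructible A : Prop :=
  exists SS : set (set V), [/\ finite_set SS,
    forall S, SS S -> zariski_locally_closed S &
    A = \bigcup_(S in SS) S].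

Definition stratification A (SS : set (set V)) : Prop :=
  [/\ finite_set SS,
      forall S, SS S -> zariski_locally_closed S,
      trivIset SS id &
      \bigcup_(S in SS) S = A].

Definition constructible_closed C : Prop :=
  euclidean_closed C /\ constructible C.
Definition constructible_open O : Prop := constructible_closed (~` O).

Definition closed_in (cl : set V -> Prop) A B : Prop :=
  exists2 C, cl C & B = A `&` C.
Definition open_in (op : set V -> Prop) A B : Prop :=
  exists2 O, op O & B = A `&` O.

(* [regular_on U f] and [regulous_on U f] depend only on the restriction of f
   to U. *)
Definition regular_on U f : Prop :=
  forall x, U x -> exists (O : set V) (p q : mpoly.mpoly (av_dim V) R),
    [/\ zariski_open O, O x &
        forall y, U y -> O y ->
          peval q (av_emb y) != 0 /\
          f y = peval p (av_emb y) / peval q (av_emb y)].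

Definition regulous_on U f : Prop :=
  {within (U : set euclidean), continuous (f : euclidean -> R)} /\
  exists2 SS, stratification U SS & forall S, SS S -> regular_on S f.

End Topologies.

(* A subset A of an affine variety is viewed as a topological space, possibly
   with a sheaf of real functions; maps out of A are represented by maps defined
   on the whole variety, of which only the values on A matter. *)

Definition open_kind (R : realType) :=
  forall V : affineVariety R, set V -> Prop.
Definition sheaf_kind (R : realType) :=
  forall V : affineVariety R, set V -> (V -> R) -> Prop.
Definition map_kind (R : realType) :=
  forall V W : affineVariety R, set V -> set W -> (V -> W) -> Prop.

Definition continuous_map (R : realType) : map_kind R :=
  fun V W A B h => (forall x, A x -> B (h x)) /\
    {within (A : set (euclidean V)),
       continuous (h : euclidean V -> euclidean W)}.

(* Since the residue fields are all R, which has no nontrivial endomorphism,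
   a morphism of locally ringed spaces between spaces with sheaves of real
   functions is a continuous map pulling back sections to sections. *)
Definition ringed_morphism (R : realType) (op : open_kind R)
    (sections : sheaf_kind R) : map_kind R :=
  fun V W A B h => (forall x, A x -> B (h x)) /\
    forall U : set W, open_in (@op W) B U ->
      open_in (@op V) A (A `&` h @^-1` U) /\
      forall g : W -> R, sections W U g ->
        sections V (A `&` h @^-1` U) (g \o h).

Definition regular_map (R : realType) : map_kind R :=
  ringed_morphism (@zariski_open R) (@regular_on R).
Definition regulous_map (R : realType) : map_kind R :=
  ringed_morphism (@constructible_open R) (@regulous_on R).

Definition isomorphism (R : realType) (mor : map_kind R)
    (V W : affineVariety R) (A : set V) (B : set W) (h : V -> W) : Prop :=
  exists k : W -> V, [/\ mor V W A B h, mor W V B A k,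
    forall x, A x -> k (h x) = x & forall y, B y -> h (k y) = y].

Section Bundles.
Variables (R : realType) (V : affineVariety R) (F : scalar_kind) (n : nat).
Implicit Types (X S U : set V) (E : set (prod_variety V F n)).

Definition fiber E (x : V) : set 'rV[scalar_ring R F]_n := [set w | E (x, w)].

Definition vector_subspace (k : nat) (W : set 'rV[scalar_ring R F]_k) : Prop :=
  GRing.submod_closed (mem W).

(* U x F^k *)
Definition prod_over (k : nat) U : set (prod_variety V F k) := U `*` setT.
Arguments prod_over : clear implicits.

(* p^-1(U), with p : E -> X the first projection *)
Definition restr E U : set (prod_variety V F n) := E `&` prod_over n U.

Definition fiberwise_linear_iso (r : nat) E U
    (h : prod_variety V F n -> prod_variety V F r) : Prop :=
  forall y, U y ->
    [/\ forall w, fiber E y w -> (h (y, w)).1 = y,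
        forall a u v, fiber E y u -> fiber E y v ->
          (h (y, a *: u + v)).2 = a *: (h (y, u)).2 + (h (y, v)).2 &
        set_bij (fiber E y) setT (fun w => (h (y, w)).2)].

Definition locally_trivial (op : open_kind R) (mor : map_kind R) X E : Prop :=
  forall x, X x -> exists U, [/\ open_in (@op V) X U, U x &
    exists (r : nat) (h : prod_variety V F n -> prod_variety V F r),
      isomorphism mor (restr E U) (prod_over r U) h /\
      fiberwise_linear_iso E U h].

(* In the next three definitions E is meant to be a subset of X x F^n whose
   fibers over X are vector subspaces. *)

Definition regulous_subbundle X E : Prop :=
  closed_in (@constructible_closed R _) (prod_over n X) E /\
  locally_trivial (@constructible_open R) (@regulous_map R) X E.

Definition topological_subbundle X E : Prop :=
  locally_trivial (@euclidean_open R) (@continuous_map R) X E.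

Definition algebraic_subbundle S E : Prop :=
  closed_in (@zariski_closed R _) (prod_over n S) E /\
  locally_trivial (@zariski_open R) (@regular_map R) S E.

End Bundles.

Arguments prod_over {R V} F k U.

(* Main.v *)
Require Import Defs.
From HB Require Import structures.
From mathcomp Require Import all_boot all_order all_algebra.
From mathcomp Require Import ring lra complex.
From mathcomp Require Import all_classical all_reals all_analysis.
From mathcomp Require mpoly.
(* The ring structures of multivariate polynomials, without their notations. *)
Import (canonicals) mpoly.

(** Both directions go through one object that depends on no choice: the
    orthogonal projector [bundle_proj E x] onto the fiber over [x], seen as a
    real matrix of size [n * real_dim F].  In each of the three settings
    (continuous, regular, regulous), the bundle is locally trivial if and only
    if the entries of the projector are locally functions of the given kind.
    A trivialization gives a frame, and the projector is a rational expression
    in the frame without real poles ([trivialization_proj]).  Conversely, if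
    [P0] is the projector at [x0] then [P0 P + (1 - P0) (1 - P)] is invertible
    near [x0] and carries the fiber over [x0] to the nearby fibers
    ([proj_locally_trivial]).  The orthogonal projector on a subspace stable
    under the scalars commutes with them, so the trivializations obtained in
    this way are linear over [F]; with real matrices, determinants and
    Cramer's rule also serve the quaternions.  What these arguments use of the
    three settings is isolated in the record [geometry].

    If the bundle is topological and algebraic on strata, its projector is
    continuous and regular on the strata, hence regulous, and so is the bundle;
    the total space is closed because it is the zero set of [w P - w].

    If the bundle is regulous, it is topological because regulous maps are
    continuous.  The stratification is built by Noetherian induction on Zariski
    closed sets: on an irreducible [Z] in which [X] is dense one has to find a
    nonempty Zariski open part over which the bundle is algebraic.  A regulous
    projector on a set dense in [Z] is regular on such a part, but the
    projector is known to be regulous only on the neighborhoods [U] over which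
    the bundle is trivial, and the trace of [U] on [Z] can fail to be dense in
    [Z], as it does near the stick of an umbrella.  So [x] must be chosen
    central in [Z]: every Euclidean neighborhood of [x] in [Z] is Zariski dense
    in [Z].  The theorem [central_points] says that all points of an
    irreducible real algebraic set are central, except on a proper algebraic
    subset.  Its proof is by induction on the number of variables.  The set is
    either a cylinder over the closure of its projection, or it is generically
    cut out over that closure by one polynomial [f] of least degree in the last
    variable; in the second case the simple roots of [f] persist over nearby
    points by the intermediate value theorem, and pseudo-division by [f]
    decides which polynomials vanish ([vanish_sheet]). *)

Set Implicit Arguments.
Unset Strict Implicit.
Unset Printing Implicit Defensive.

Import Order.TTheory GRing.Theory Num.Theory.
Import numFieldNormedType.Exports.

Local Open Scope classical_set_scope.
Local Open Scope ring_scope.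

(** * Classes of functions closed under field operations *)

Section PolynomialEvaluation.
Variables (R : realType) (m : nat).
Implicit Types (p q : mpoly.mpoly m R) (x : 'rV[R]_m).

Lemma pevalD p q x : peval (p + q) x = peval p x + peval q x.
Proof. exact: mpoly.mevalD. Qed.
Lemma pevalM p q x : peval (p * q) x = peval p x * peval q x.
Proof. exact: mpoly.mevalM. Qed.
Lemma peval0 x : peval 0 x = 0.
Proof. exact: mpoly.meval0. Qed.
Lemma peval1 x : peval 1 x = 1.
Proof. exact: mpoly.meval1. Qed.
Lemma pevalC c x : peval (mpoly.mpolyC m c) x = c.
Proof. exact: mpoly.mevalC. Qed.
Lemma pevalX i x : peval (mpoly.mpolyX R (mpoly.mnm1 i)) x = x 0 i.
Proof. exact: mpoly.mevalXU. Qed.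

End PolynomialEvaluation.

Section FunctionClass.
Variables (R : realType) (T : Type) (A : set T).

(** All that linear algebra with entries in a family of functions requires.
    Membership may depend only on the values on [A], because maps out of [A]
    are represented by maps defined everywhere. *)
Record function_class (K : set (T -> R)) : Prop := FunctionClass {
  fc_cst : forall c, K (fun=> c);
  fc_add : forall f g, K f -> K g -> K (fun x => f x + g x);
  fc_mul : forall f g, K f -> K g -> K (fun x => f x * g x);
  fc_inv : forall f, K f -> (forall x, A x -> f x != 0) ->
    K (fun x => (f x)^-1);
  fc_ext : forall f g, (forall x, A x -> f x = g x) -> K f -> K g }.

Variables (K : set (T -> R)) (fcK : function_class K).

Lemma fc_opp f : K f -> K (fun x => - f x).
Proof.
move=> Kf; apply: (fc_ext fcK _ (fc_mul fcK (fc_cst fcK (-1)) Kf)) => x _.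
by rewrite mulN1r.
Qed.

Lemma fc_sum (I : Type) (r : seq I) (f : I -> T -> R) :
  (forall i, K (f i)) -> K (fun x => \sum_(i <- r) f i x).
Proof.
move=> Kf; elim: r => [|i r IH].
  by apply: (fc_ext fcK _ (fc_cst fcK 0)) => x _; rewrite big_nil.
by apply: (fc_ext fcK _ (fc_add fcK (Kf i) IH)) => x _; rewrite big_cons.
Qed.

Lemma fc_prod (I : Type) (r : seq I) (f : I -> T -> R) :
  (forall i, K (f i)) -> K (fun x => \prod_(i <- r) f i x).
Proof.
move=> Kf; elim: r => [|i r IH].
  by apply: (fc_ext fcK _ (fc_cst fcK 1)) => x _; rewrite big_nil.
by apply: (fc_ext fcK _ (fc_mul fcK (Kf i) IH)) => x _; rewrite big_cons.
Qed.

Lemma fc_exp f k : K f -> K (fun x => f x ^+ k).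
Proof.
move=> Kf; elim: k => [|k IH]; first exact: (fc_cst fcK 1).
by apply: (fc_ext fcK _ (fc_mul fcK Kf IH)) => x _; rewrite exprS.
Qed.

Lemma fc_peval m (h : T -> 'rV[R]_m) (p : mpoly.mpoly m R) :
  (forall i, K (fun x => h x 0 i)) -> K (fun x => peval p (h x)).
Proof.
move=> Kh.
apply: (@fc_ext K fcK (fun x => \sum_(k <- mpoly.msupp p)
  mpoly.mcoeff k p * \prod_(i < m) h x 0 i ^+ mpoly.fun_of_multinom k i)).
  by move=> x _; rewrite /peval mpoly.mevalE.
apply: fc_sum => k; apply: fc_mul => //; first exact: fc_cst.
by apply: fc_prod => i; exact: fc_exp.
Qed.

Definition mx_class p q (M : T -> 'M[R]_(p, q)) : Prop :=
  forall i j, K (fun x => M x i j).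

Lemma mx_class_cst p q (M : 'M[R]_(p, q)) : mx_class (fun=> M).
Proof. by move=> i j; exact: fc_cst. Qed.

Lemma mx_class_ext p q (M N : T -> 'M[R]_(p, q)) :
  (forall x, A x -> M x = N x) -> mx_class M -> mx_class N.
Proof. by move=> MN KM i j; apply: (fc_ext fcK _ (KM i j)) => x /MN->. Qed.

Lemma mx_classD p q (M N : T -> 'M[R]_(p, q)) :
  mx_class M -> mx_class N -> mx_class (fun x => M x + N x).
Proof.
move=> KM KN i j; apply: (fc_ext fcK _ (fc_add fcK (KM i j) (KN i j))) => x _.
by rewrite mxE.
Qed.

Lemma mx_classN p q (M : T -> 'M[R]_(p, q)) :
  mx_class M -> mx_class (fun x => - M x).
Proof.
move=> KM i j; apply: (fc_ext fcK _ (fc_opp (KM i j))) => x _.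
by rewrite mxE.
Qed.

Lemma mx_classT p q (M : T -> 'M[R]_(p, q)) :
  mx_class M -> mx_class (fun x => (M x)^T).
Proof.
by move=> KM i j; apply: (fc_ext fcK _ (KM j i)) => x _; rewrite mxE.
Qed.

Lemma mx_classM p q r (M : T -> 'M[R]_(p, q)) (N : T -> 'M[R]_(q, r)) :
  mx_class M -> mx_class N -> mx_class (fun x => M x *m N x).
Proof.
move=> KM KN i j.
apply: (@fc_ext K fcK (fun x => \sum_k M x i k * N x k j)).
  by move=> x _; rewrite mxE.
by apply: fc_sum => k; apply: fc_mul.
Qed.

Lemma fc_det p (M : T -> 'M[R]_p) : mx_class M -> K (fun x => \det (M x)).
Proof.
move=> KM; apply: fc_sum => s; apply: fc_mul => //; first exact: fc_cst.
by apply: fc_prod => i; exact: KM.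
Qed.

(** By Cramer's rule, the determinant is the only function to invert. *)
Lemma mx_classV p (M : T -> 'M[R]_p) : mx_class M ->
  (forall x, A x -> \det (M x) != 0) -> mx_class (fun x => invmx (M x)).
Proof.
move=> KM M0 i j.
apply: (@fc_ext K fcK (fun x => (\det (M x))^-1 * cofactor (M x) j i)).
  by move=> x Ax; rewrite /invmx unitmxE unitfE M0 // !mxE.
apply: fc_mul => //; first by apply: fc_inv => //; exact: fc_det.
apply: fc_mul => //; first exact: fc_cst.
apply: fc_det => k l; apply: (fc_ext fcK _ (KM (lift j k) (lift i l))).
by move=> x _; rewrite !mxE.
Qed.

End FunctionClass.

Lemma function_classI (R : realType) (T : Type) (A : set T)
    (K L : set (T -> R)) :
  function_class A K -> function_class A L -> function_class A (K `&` L).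
Proof.
move=> fK fL.
split=> [c|f g [Kf Lf] [Kg Lg]|f g [Kf Lf] [Kg Lg]|f [Kf Lf] f0|f g fg [Kf Lf]].
- by split; [exact: (fc_cst fK)|exact: (fc_cst fL)].
- by split; [exact: (fc_add fK)|exact: (fc_add fL)].
- by split; [exact: (fc_mul fK)|exact: (fc_mul fL)].
- by split; [exact: (fc_inv fK)|exact: (fc_inv fL)].
- by split; [exact: (fc_ext fK fg)|exact: (fc_ext fL fg)].
Qed.

(** * Zariski topology and regular functions *)

Section ZariskiTopology.
Variables (R : realType) (V : affineVariety R).
Implicit Types (A B C O S U : set V) (f g : V -> R).
Local Notation poly := (mpoly.mpoly (av_dim V) R).

Definition vanish A : set poly :=
  [set p | forall x, A x -> peval p (av_emb x) = 0].

(** The defining equations can be taken to be all the polynomials that vanish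
    on the set. *)
Lemma zariski_closedP C : zariski_closed C <->
  forall x, (forall p, vanish C p -> peval p (av_emb x) = 0) -> C x.
Proof.
split=> [[P ->] x xP p Pp|CP]; first by apply: xP => y; exact.
exists (vanish C); apply/seteqP; split=> [x Cx p|x xC]; first exact.
exact: CP.
Qed.

Lemma zariski_closed_bigcap (I : Type) (D : set I) (C : I -> set V) :
  (forall i, D i -> zariski_closed (C i)) ->
  zariski_closed (\bigcap_(i in D) C i).
Proof.
move=> clC; apply/zariski_closedP => x xC i Di.
apply: (zariski_closedP _).1 (clC i Di) _ _ => p Cp; apply: xC.
by move=> y Cy; apply: Cp; exact: Cy.
Qed.

Lemma zariski_closedU C1 C2 :
  zariski_closed C1 -> zariski_closed C2 -> zariski_closed (C1 `|` C2).
Proof.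
move=> /zariski_closedP cl1 /zariski_closedP cl2; apply/zariski_closedP => x xC.
apply: contrapT => /not_orP[nC1 nC2].
apply: nC1; apply: cl1 => p C1p; apply: contrapT => /eqP px.
apply: nC2; apply: cl2 => q C2q.
have /eqP : peval (p * q) (av_emb x) = 0.
  apply: xC => y [C1y|C2y]; rewrite pevalM; first by rewrite C1p ?mul0r.
  by rewrite C2q ?mulr0.
by rewrite pevalM mulf_eq0 (negbTE px) => /eqP.
Qed.

Lemma zariski_closed0 : zariski_closed (set0 : set V).
Proof.
apply/zariski_closedP => x x0; have /eqP : peval 1 (av_emb x) = 0.
  by apply: x0 => y [].
by rewrite peval1 oner_eq0.
Qed.

Lemma zariski_closedT : zariski_closed (setT : set V).
Proof. exact/zariski_closedP. Qed.

Lemma zariski_closedI C1 C2 :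
  zariski_closed C1 -> zariski_closed C2 -> zariski_closed (C1 `&` C2).
Proof.
move=> cl1 cl2; rewrite -bigcap2E; apply: zariski_closed_bigcap => i _.
rewrite /bigcap2; case: ifP => // _; case: ifP => // _.
exact: zariski_closedT.
Qed.

Lemma zariski_closed_zero (p : poly) :
  zariski_closed [set x : V | peval p (av_emb x) = 0].
Proof. by apply/zariski_closedP => x; apply=> y. Qed.

Lemma zariski_openI O1 O2 :
  zariski_open O1 -> zariski_open O2 -> zariski_open (O1 `&` O2).
Proof. by rewrite /zariski_open setCI; exact: zariski_closedU. Qed.

Lemma zariski_openT : zariski_open (setT : set V).
Proof. by rewrite /zariski_open setCT; exact: zariski_closed0. Qed.

Lemma zariski_open_closedC C : zariski_closed C -> zariski_open (~` C).
Proof. by rewrite /zariski_open setCK. Qed.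

Lemma zariski_open_nonzero (p : poly) :
  zariski_open [set x : V | peval p (av_emb x) != 0].
Proof.
rewrite /zariski_open.
suff -> : ~` [set x : V | peval p (av_emb x) != 0] =
  [set x | peval p (av_emb x) = 0] by exact: zariski_closed_zero.
by apply/seteqP; split=> x /=; [move/negP/negPn/eqP|move=> ->; rewrite eqxx].
Qed.

Lemma locally_closedI A B : zariski_locally_closed A ->
  zariski_locally_closed B -> zariski_locally_closed (A `&` B).
Proof.
move=> [C [ O [cC oO ->]]] [C' [ O' [cC' oO' ->]]]; exists (C `&` C'), (O `&` O').
by split; [exact: zariski_closedI|exact: zariski_openI|rewrite setIACA].
Qed.

Lemma zariski_closed_locally_closed C :
  zariski_closed C -> zariski_locally_closed C.
Proof.
by exists C, setT; split=> //; [exact: zariski_openT|rewrite setIT].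
Qed.

Lemma zariski_open_locally_closed O :
  zariski_open O -> zariski_locally_closed O.
Proof.
by exists setT, O; split=> //; [exact: zariski_closedT|rewrite setTI].
Qed.

Lemma stratification_constructible A SS : stratification A SS -> constructible A.
Proof. by case=> fin lc _ <-; exists SS. Qed.

Lemma constructible_of_lc A :
  zariski_locally_closed A -> constructible A.
Proof.
by move=> lcA; exists [set A]; split; rewrite ?bigcup_set1// => _ ->.
Qed.

Lemma constructibleU A B :
  constructible A -> constructible B -> constructible (A `|` B).
Proof.
move=> [SS [fS lS ->]] [TT [fT lT ->]]; exists (SS `|` TT); split.
- by rewrite finite_setU.
- by move=> S [/lS|/lT].
- by rewrite bigcup_setU.
Qed.

Lemma constructibleI A B :
  constructible A -> constructible B -> constructible (A `&` B).
Proof.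
move=> [SS [fS lS ->]] [TT [fT lT ->]].
exists [set S `&` S' | S in SS & S' in TT]; split.
- exact: finite_image2 fS fT.
- by move=> _ [S /lS ? [S' /lT ? <-]]; exact: locally_closedI.
- apply/seteqP; split=> x.
    by move=> [[S hS xS] [S' hS' xS']]; exists (S `&` S') => //;
      exists S => //; exists S'.
  by move=> [_ [S hS [S' hS' <-]] [xS xS']]; split; [exists S|exists S'].
Qed.


Lemma regular_onS A B f : A `<=` B -> regular_on B f -> regular_on A f.
Proof.
move=> AB rf x /AB /rf[ O [p [q [? ? pq]]]].
by exists O, p, q; split=> // y /AB; exact: pq.
Qed.

Lemma regular_on_local A f :
  (forall x, A x -> exists O, [/\ zariski_open O, O x & regular_on (A `&` O) f]) ->
  regular_on A f.
Proof.
move=> loc x Ax; have [ O [oO Ox rf]] := loc x Ax.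
have [ O' [p [q [oO' O'x pq]]]] := rf x (conj Ax Ox).
exists (O `&` O'), p, q; split=> //; first exact: zariski_openI.
by move=> y Ay [Oy O'y]; exact: pq.
Qed.

Lemma regular_on_peval A (p : poly) :
  regular_on A (fun x => peval p (av_emb x)).
Proof.
move=> x Ax; exists setT, p, 1; split=> //; first exact: zariski_openT.
by move=> y _ _; rewrite peval1 divr1 oner_eq0.
Qed.

Lemma function_class_regular A : function_class A (@regular_on R V A).
Proof.
split=> [c|f g rf rg x Ax|f g rf rg x Ax|f rf f0 x Ax|f g fg rf x Ax].
- move=> x Ax; exists setT, (mpoly.mpolyC _ c), 1.
  split=> //; first exact: zariski_openT.
  by move=> y _ _; rewrite peval1 divr1 oner_eq0 pevalC.
- have [ O [p [q [oO Ox pq]]]] := rf x Ax.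
  have [ O' [p' [q' [oO' Ox' pq']]]] := rg x Ax.
  exists (O `&` O'), (p * q' + p' * q), (q * q').
  split=> //; first exact: zariski_openI.
  move=> y Ay [/(pq y Ay)[q0 ->] /(pq' y Ay)[q0' ->]].
  by rewrite !(pevalM, pevalD) mulf_neq0// addf_div.
- have [ O [p [q [oO Ox pq]]]] := rf x Ax.
  have [ O' [p' [q' [oO' Ox' pq']]]] := rg x Ax.
  exists (O `&` O'), (p * p'), (q * q').
  split=> //; first exact: zariski_openI.
  move=> y Ay [/(pq y Ay)[q0 ->] /(pq' y Ay)[q0' ->]].
  by rewrite !pevalM mulf_neq0// mulf_div.
- have [ O [p [q [oO Ox pq]]]] := rf x Ax.
  exists O, q, p; split=> // y Ay /(pq y Ay)[q0 fy].
  rewrite fy invf_div; split=> //; apply: contraNneq (f0 y Ay) => py.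
  by rewrite fy py mul0r.
- have [ O [p [q [oO Ox pq]]]] := rf x Ax.
  by exists O, p, q; split=> // y Ay; rewrite -fg//; exact: pq.
Qed.

(** A regular function is a quotient of polynomials only locally, so that no
    numerator cuts out its zero set.  The intersection of all closed sets that
    contain the zero set does: outside the zero set, a local numerator provides
    such a closed set that misses the given point. *)
Lemma regular_on_zero A f : regular_on A f ->
  exists2 C, zariski_closed C & A `&` [set x | f x = 0] = A `&` C.
Proof.
move=> rf; exists (\bigcap_(C in [set C | zariski_closed C /\
    A `&` [set x | f x = 0] `<=` C]) C).
  by apply: zariski_closed_bigcap => C [].
apply/seteqP; split=> x [Ax].
  by move=> fx; split=> // C [_]; apply.
move=> xC; split=> //=.
have [ O [p [q [oO Ox pq]]]] := rf x Ax.
have : (~` O `|` [set x : V | peval p (av_emb x) = 0]) x.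
  apply: xC; split; first by apply: zariski_closedU => //; exact: zariski_closed_zero.
  move=> y [Ay fy]; have [Oy|] := pselect (O y); [right|by left].
  have [q0 fE] := pq y Ay Oy; apply/eqP; move: fE => /esym/eqP.
  by rewrite /= fy mulf_eq0 invr_eq0 (negbTE q0) orbF.
by case=> // px; have [_ ->] := pq x Ax Ox; rewrite px mul0r.
Qed.

End ZariskiTopology.

(** * Continuity, and maps with regular or regulous coordinates *)

Section Continuity.
Variables (R : realType) (T : topologicalType).
Implicit Types (A B : set T).

Lemma function_class_continuous A :
  function_class A [set f : T -> R | {within A, continuous f}].
Proof.
split=> [c|f g|f g|f|f g fg] /=; last first.
- by apply: subspace_eq_continuous => x; rewrite inE => /fg.
all: rewrite ?subspace_continuousP.
- by move=> cf f0 x Ax; apply: cvgV; [exact: f0|exact: cf].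
- by move=> cf cg x Ax; apply: cvgM; [exact: cf|exact: cg].
- by move=> cf cg x Ax; apply: cvgD; [exact: cf|exact: cg].
- by move=> x _; exact: cvg_cst.
Qed.

Lemma continuous_coordP m A (h : T -> 'rV[R]_m) : {within A, continuous h} <->
  forall i j, {within A, continuous (fun x => h x i j)}.
Proof.
split=> [ch i j|ch].
  move: ch; rewrite !subspace_continuousP => ch x Ax.
  exact: (cvg_comp h (fun v : 'rV[R]_m => v i j) (ch x Ax)
    (@coord_continuous _ _ _ i j _)).
have {}ch i j := (@subspace_continuousP _ _ _ _).1 (ch i j).
apply/subspace_continuousP => x Ax N [P hP PN].
have : \forall y \near within A (nbhs x), forall i j, P i j (h y i j).
  apply: filter_forall => i; apply: filter_forall => j.
  exact: (ch i j x Ax _ (hP i j)).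
by apply: filterS => y Py; exact: PN.
Qed.

Lemma subspace_continuous_comp (S U : topologicalType) A (B : set S)
    (h : T -> S) (g : S -> U) : A `<=` h @^-1` B ->
  {within A, continuous h} -> {within B, continuous g} ->
  {within A, continuous (g \o h)}.
Proof.
move=> AB /subspace_continuousP ch /subspace_continuousP cg.
apply/subspace_continuousP => x Ax N /(cg (h x) (AB x Ax)) /(ch x Ax) near_x.
change (nbhs x (fun y => A y -> N (g (h y)))).
have : nbhs x (fun y => A y -> B (h y) -> N (g (h y))) := near_x.
by apply: filterS => y hy Ay; apply: hy => //; exact: AB.
Qed.

Lemma within_continuous_preimage (S : topologicalType) A (h : T -> S)
    (W : set S) : {within A, continuous h} -> open W ->
  exists2 O, open O & A `&` h @^-1` W = A `&` O.
Proof.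
move=> /continuousP/[apply]/open_subspaceP[ O oO OA]; exists O => //.
by rewrite setIC -OA setIC.
Qed.

Lemma within_continuous_preimage_closed (S : topologicalType) A (h : T -> S)
    (C : set S) : {within A, continuous h} -> closed C ->
  exists2 C', closed C' & A `&` h @^-1` C = A `&` C'.
Proof.
move=> ch /closed_openC/(within_continuous_preimage ch)[ O oO AO].
exists (~` O); first exact: open_closedC.
have /seteqP[s1 s2] := AO.
apply/seteqP; split=> x [Ax hx]; split=> //.
  by move=> Ox; have [_] := s2 x (conj Ax Ox).
by apply: contrapT => nC; have [_] := s1 x (conj Ax nC).
Qed.

Lemma within_continuous_local (S : topologicalType) A (f : T -> S) :
  (forall x, A x -> exists O, [/\ open O, O x &
     {within A `&` O, continuous f}]) -> {within A, continuous f}.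
Proof.
move=> loc; apply/subspace_continuousP => x Ax N Nfx.
have [ O [oO Ox /subspace_continuousP cf]] := loc x Ax.
have nO : nbhs x O by exact: open_nbhs_nbhs.
change (nbhs x (fun y => A y -> N (f y))).
have cfx : nbhs x (fun y => (A `&` O) y -> N (f y)) := cf x (conj Ax Ox) N Nfx.
by apply: filterS (filterI nO cfx) => y [Oy hy] Ay; exact: hy.
Qed.

End Continuity.

Section MapsOfVarieties.
Variables (R : realType) (V W : affineVariety R).
Implicit Types (A : set V) (B C : set W) (h : V -> W).

Definition cont_on (V : affineVariety R) (A : set V) : set (V -> R) :=
  [set f | {within (A : set (euclidean V)), continuous (f : euclidean V -> R)}].

(** The coordinates are those of the affine space that contains [W]. *)
Definition coords_in (K : set (V -> R)) h : Prop :=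
  mx_class K (fun x => av_emb (h x)).

Lemma continuous_map_coords A B h :
  continuous_map A B h <->
  (forall x, A x -> B (h x)) /\ coords_in (cont_on A) h.
Proof.
split=> [[AB ch]|[AB ch]]; split=> //.
  apply/(continuous_coordP (T := euclidean V)).
  apply: (subspace_continuous_comp (T := euclidean V) (S := euclidean W)
    (B := setT)) ch _ => //.
  by apply: continuous_subspaceT; exact: initial_continuous.
apply: continuous_comp_initial.
exact/(continuous_coordP (T := euclidean V)).
Qed.

Lemma cont_on_comp A B h (g : W -> R) : coords_in (cont_on A) h ->
  cont_on B g -> cont_on (A `&` h @^-1` B) (g \o h).
Proof.
move=> ch cg.
apply: (subspace_continuous_comp (T := euclidean V) (S := euclidean W)) cg.
  by move=> x [].
apply: (continuous_comp_initial (X := subspace _)).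
apply/(continuous_coordP (T := euclidean V)) => i j.
by apply: continuous_subspaceW (ch i j); move=> x [].
Qed.

(** A polynomial on [W] becomes a regular function on [A], whose zero set is
    relatively closed. *)
Lemma preimage_zariski_closed A h C :
  coords_in (@regular_on R V A) h -> zariski_closed C ->
  exists2 C', zariski_closed C' & A `&` h @^-1` C = A `&` C'.
Proof.
move=> rh [P CP]; exists (\bigcap_(D in [set D | zariski_closed D /\
    A `&` h @^-1` C `<=` D]) D).
  by apply: zariski_closed_bigcap => D [].
apply/seteqP; split=> x [Ax hx]; split=> //; first by move=> D [_]; exact.
rewrite /preimage /= CP => p Pp.
have [] := @regular_on_zero _ _ A (fun x => peval p (av_emb (h x))).
  by apply: (fc_peval (function_class_regular A)) => i; exact: rh.
move=> D clD AD.
suff : (A `&` D) x by rewrite -AD => -[].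
split=> //; apply: hx; split=> // y [Ay hy].
suff : (A `&` D) y by case.
by rewrite -AD; split=> //=; move: hy; rewrite /preimage /= CP; exact.
Qed.

Lemma preimage_zariski_open A h (U : set W) :
  coords_in (@regular_on R V A) h -> zariski_open U ->
  exists2 U', zariski_open U' & A `&` h @^-1` U = A `&` U'.
Proof.
move=> rh /(preimage_zariski_closed rh)[C clC AC].
exists (~` C); first exact: zariski_open_closedC.
have /seteqP[s1 s2] := AC.
apply/seteqP; split=> x [Ax hx]; split=> //.
  by move=> Cx; have [_] := s2 x (conj Ax Cx).
by apply: contrapT => nC; have [_] := s1 x (conj Ax nC).
Qed.

Lemma preimage_locally_closed A h B : coords_in (@regular_on R V A) h ->
  zariski_locally_closed A -> zariski_locally_closed B ->
  zariski_locally_closed (A `&` h @^-1` B).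
Proof.
move=> rh lcA [C [U [clC opU ->]]].
have [C' clC' AC] := preimage_zariski_closed rh clC.
have [U' opU' AU] := preimage_zariski_open rh opU.
rewrite preimage_setI -[A]setIid setIACA AC AU setIACA setIid.
by apply: locally_closedI => //; exists C', U'.
Qed.

Lemma regular_on_comp A B h (g : W -> R) : coords_in (@regular_on R V A) h ->
  regular_on B g -> regular_on (A `&` h @^-1` B) (g \o h).
Proof.
move=> rh rg; apply: regular_on_local => x [Ax Bx].
have [U [p [q [opU Ux pq]]]] := rg _ Bx.
have [U' opU' AU] := preimage_zariski_open rh opU.
exists U'; have /seteqP[s1 s2] := AU.
have U'x : U' x by have [] := s1 x (conj Ax Ux).
split=> //; set D := (X in regular_on X _).
have DA : D `<=` A by move=> y [[]].
have rpq : regular_on D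
    (fun y => peval p (av_emb (h y)) * (peval q (av_emb (h y)))^-1).
  have fcD := function_class_regular D.
  apply: (fc_mul fcD); last apply: (fc_inv fcD).
  - apply: (fc_peval fcD) => i; apply: regular_onS DA _; exact: rh.
  - apply: (fc_peval fcD) => i; apply: regular_onS DA _; exact: rh.
  - move=> y [[Ay By] U'y]; have [_ Uy] := s2 y (conj Ay U'y).
    by have [] := pq _ By Uy.
apply: (fc_ext (function_class_regular D)) rpq => y [[Ay By] U'y].
have [_ Uy] := s2 y (conj Ay U'y).
by have [_ /= ->] := pq _ By Uy.
Qed.

Definition strat_regular (V : affineVariety R) (SS : set (set V)) :
    set (V -> R) :=
  [set f | forall S, SS S -> regular_on S f].

Lemma function_class_strat_regular (V' : affineVariety R) (A : set V') SS :
  (forall S, SS S -> S `<=` A) -> function_class A (strat_regular SS).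
Proof.
move=> SA; split=> [c S SS_S|f g rf rg S SS_S|f g rf rg S SS_S|
  f rf f0 S SS_S|f g fg rf S SS_S]; have fcS := function_class_regular S.
- exact: (fc_cst fcS).
- by apply: (fc_add fcS); [exact: rf|exact: rg].
- by apply: (fc_mul fcS); [exact: rf|exact: rg].
- by apply: (fc_inv fcS); [exact: rf|move=> x /(SA _ SS_S); exact: f0].
- by apply: (fc_ext fcS) (rf _ SS_S) => x /(SA _ SS_S); exact: fg.
Qed.

Lemma stratum_sub (V' : affineVariety R) (A : set V') SS S :
  stratification A SS -> SS S -> S `<=` A.
Proof. by move=> [_ _ _ <-] SS_S; exact: bigcup_sup. Qed.

(** For [h] the identity, this is the common refinement. *)
Definition refinement (SS : set (set V)) (TT : set (set W)) h :=
  [set S `&` h @^-1` T | S in SS & T in TT].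

Lemma stratification_refinement A B SS TT h : stratification A SS ->
  stratification B TT -> coords_in (strat_regular SS) h ->
  stratification (A `&` h @^-1` B) (refinement SS TT h).
Proof.
move=> [finS lcS trS <-] [finT lcT trT <-] rh; split.
- exact: finite_image2 finS finT.
- move=> _ [S SS_S [T TT_T <-]]; apply: preimage_locally_closed.
  + by move=> i j; exact: rh.
  + exact: lcS.
  + exact: lcT.
- move=> _ _ [S SS_S [T TT_T <-]] [S' SS_S' [T' TT_T' <-]].
  move=> [x [[Sx Tx] [S'x T'x]]].
  have -> : S = S' by apply: trS => //; exists x.
  by have -> : T = T' by apply: trT => //; exists (h x).
- apply/seteqP; split=> x.
    move=> [_ [S SS_S [T TT_T <-]] [Sx Tx]].
    by split; [exists S|exists T].
  move=> [[S SS_S Sx] [T TT_T Tx]].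
  by exists (S `&` h @^-1` T) => //; exists S => //; exists T.
Qed.

Lemma regulous_on_comp A B SS h (g : W -> R) : stratification A SS ->
  coords_in (cont_on A `&` strat_regular SS) h -> regulous_on B g ->
  regulous_on (A `&` h @^-1` B) (g \o h).
Proof.
move=> stA rh [cg [TT stB rg]]; split.
  by apply: cont_on_comp cg => i j; exact: (rh i j).1.
have srh : coords_in (strat_regular SS) h by move=> i j; exact: (rh i j).2.
exists (refinement SS TT h); first exact: stratification_refinement.
move=> _ [S SS_S [T TT_T <-]]; apply: regular_on_comp; last exact: rg.
by move=> i j; exact: srh.
Qed.

End MapsOfVarieties.

(** * Stratifications, constructible sets and morphisms *)

Section Strata.
Variables (R : realType) (V : affineVariety R).
Implicit Types (A B C S X : set V).

Lemma regular_on_coord A i j : regular_on A (fun x => av_emb x i j).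
Proof.
have := regular_on_peval (A := A) (mpoly.mpolyX R (mpoly.mnm1 j)).
by apply: (fc_ext (function_class_regular A)) => x _; rewrite ord1 pevalX.
Qed.

Lemma strat_regular_coord SS i j :
  strat_regular SS (fun x : V => av_emb x i j).
Proof. by move=> S _; exact: regular_on_coord. Qed.

Lemma cont_on_coord A i j : cont_on A (fun x : V => av_emb x i j).
Proof.
apply: continuous_subspaceT => x.
apply: (@continuous_comp _ _ _ (@av_emb R V : euclidean V -> _)
  (fun v : 'rV_(av_dim V) => v i j)); first exact: initial_continuous.
exact: coord_continuous.
Qed.

Definition stratifiable A : Prop := exists SS, stratification A SS.

Lemma stratifiableI A B : stratifiable A -> stratifiable B ->
  stratifiable (A `&` B).
Proof.
move=> [SS stA] [TT stB]; exists (refinement SS TT id).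
by apply: stratification_refinement => // i j; exact: strat_regular_coord.
Qed.

Lemma stratificationU A B SS TT : stratification A SS ->
  stratification B TT -> A `&` B = set0 ->
  stratification (A `|` B) (SS `|` TT).
Proof.
move=> [finS lcS trS <-] [finT lcT trT <-] AB0.
have dis S T x : SS S -> TT T -> S x -> T x -> False.
  move=> SS_S TT_T Sx Tx; suff : set0 x by [].
  by rewrite -AB0; split; [exists S|exists T].
split.
- by rewrite finite_setU.
- by move=> S [/lcS|/lcT].
- move=> S S' [SS_S|TT_S] [SS_S'|TT_S'] [x [Sx S'x]].
  + by apply: trS => //; exists x.
  + by have := dis _ _ _ SS_S TT_S' Sx S'x.
  + by have := dis _ _ _ SS_S' TT_S S'x Sx.
  + by apply: trT => //; exists x.
- by rewrite bigcup_setU.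
Qed.

Lemma stratifiableU A B : stratifiable A -> stratifiable B -> A `&` B = set0 ->
  stratifiable (A `|` B).
Proof.
by move=> [SS stA] [TT stB] AB0; exists (SS `|` TT); exact: stratificationU.
Qed.

Lemma stratifiable_lc A : zariski_locally_closed A -> stratifiable A.
Proof.
move=> lcA; exists [set A]; split.
- exact: finite_set1.
- by move=> _ ->.
- by move=> _ _ -> ->.
- by rewrite bigcup_set1.
Qed.

(** The complement of the trace of a closed set [C] on an open set [U] is the
    disjoint union of the complement of [C] and of the part of [C] outside
    [U]. *)
Lemma stratifiableC_lc A : zariski_locally_closed A -> stratifiable (~` A).
Proof.
move=> [C [U [clC opU ->]]].
have -> : ~` (C `&` U) = ~` C `|` (C `&` ~` U).
  apply/seteqP; split=> x /=; last by move=> [nC|[Cx nU]] [].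
  move=> nCU; have [Cx|] := pselect (C x); last by left.
  by right; split=> // Ux; apply: nCU.
apply: stratifiableU.
- by apply/stratifiable_lc/zariski_open_locally_closed/zariski_open_closedC.
- by apply/stratifiable_lc/zariski_closed_locally_closed/zariski_closedI.
- by rewrite setIA setICl set0I.
Qed.

(** A finite union is made disjoint by cutting the previous strata down to the
    complement of each new piece. *)
Lemma constructible_stratifiable_both A : constructible A ->
  stratifiable A /\ stratifiable (~` A).
Proof.
move=> [SS [/finite_seqP[s ->] lcS ->]].
have {lcS} : forall S, S \in s -> zariski_locally_closed S by [].
elim: s => [|S s IH] lcS.
  rewrite set_nil !bigcup_set0 setC0; split.
    exact/stratifiable_lc/zariski_closed_locally_closed/zariski_closed0.
  exact/stratifiable_lc/zariski_closed_locally_closed/zariski_closedT.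
have -> : [set` S :: s] = S |` [set` s].
  apply/seteqP; split=> T /=; rewrite inE; first by case/orP=> [/eqP|]; [left|right].
  by case=> [->|->]; rewrite ?eqxx ?orbT.
rewrite bigcup_setU1; set B := \bigcup_(i in _) i.
have lcs : zariski_locally_closed S by apply: lcS; rewrite mem_head.
have [stA stAC] : stratifiable B /\ stratifiable (~` B).
  by apply: IH => T Ts; apply: lcS; rewrite inE Ts orbT.
split; last by rewrite setCU; apply: stratifiableI => //; exact: stratifiableC_lc.
have -> : S `|` B = S `|` (B `&` ~` S).
  apply/seteqP; split=> x; last by move=> [Sx|[Ax _]]; [left|right].
  move=> [Sx|Ax]; first by left.
  by have [Sx|nSx] := pselect (S x); [left|right].
apply: stratifiableU; first exact: stratifiable_lc.
  by apply: stratifiableI => //; exact: stratifiableC_lc.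
by rewrite setIC -setIA setICl setI0.
Qed.

Lemma constructible_stratifiable A : constructible A -> stratifiable A.
Proof. by move=> /constructible_stratifiable_both[]. Qed.

Lemma constructibleC A : constructible A -> constructible (~` A).
Proof.
move=> /constructible_stratifiable_both[_ [SS]].
exact: stratification_constructible.
Qed.

Lemma function_class_cont_on A : function_class A (cont_on A).
Proof. exact: (@function_class_continuous _ (euclidean V)). Qed.

Lemma regulous_on_stratified A SS f : stratification A SS ->
  (cont_on A `&` strat_regular SS) f -> regulous_on A f.
Proof. by move=> stA [cf rf]; split=> //; exists SS. Qed.

Lemma regulous_on2 A f g : regulous_on A f -> regulous_on A g ->
  exists2 SS, stratification A SS &
    (cont_on A `&` strat_regular SS) f /\ (cont_on A `&` strat_regular SS) g.
Proof.
move=> [cf [SS stS rf]] [cg [TT stT rg]]; exists (refinement SS TT id).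
  rewrite -[A]setIid.
  by apply: stratification_refinement => // i j; exact: strat_regular_coord.
split; split=> // _ [S SS_S [T TT_T <-]].
  by apply: (regular_onS (B := S)); [move=> x []|exact: rf].
by apply: (regular_onS (B := T)); [move=> x []|exact: rg].
Qed.

Lemma function_class_cont_strat A SS : stratification A SS ->
  function_class A (cont_on A `&` strat_regular SS).
Proof.
move=> stA; apply: function_classI; first exact: function_class_cont_on.
by apply: function_class_strat_regular => S; exact: stratum_sub stA.
Qed.

Lemma function_class_regulous A : constructible A ->
  function_class A (regulous_on A).
Proof.
move=> /constructible_stratifiable[SS0 stA0].
split=> [c|f g rf rg|f g rf rg|f rf f0|f g fg rf].
- apply: (regulous_on_stratified stA0).
  exact: (fc_cst (function_class_cont_strat stA0)).
- have [SS stA [Kf Kg]] := regulous_on2 rf rg.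
  apply: (regulous_on_stratified stA).
  exact: (fc_add (function_class_cont_strat stA)).
- have [SS stA [Kf Kg]] := regulous_on2 rf rg.
  apply: (regulous_on_stratified stA).
  exact: (fc_mul (function_class_cont_strat stA)).
- have [SS stA [Kf _]] := regulous_on2 rf rf.
  apply: (regulous_on_stratified stA).
  exact: (fc_inv (function_class_cont_strat stA)).
- have [SS stA [Kf _]] := regulous_on2 rf rf.
  apply: (regulous_on_stratified stA).
  exact: (fc_ext (function_class_cont_strat stA) fg).
Qed.

Lemma cont_on_zero A f : cont_on A f ->
  exists2 C, euclidean_closed C & A `&` [set x | f x = 0] = A `&` C.
Proof.
move=> cf.
have [] := within_continuous_preimage_closed (T := euclidean V) (C := [set 0]) cf.
  exact: closed_eq.
by move=> C clC AC; exists C.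
Qed.

Lemma euclidean_closedI A B :
  euclidean_closed A -> euclidean_closed B -> euclidean_closed (A `&` B).
Proof. exact: closedI. Qed.

Lemma euclidean_closedU A B :
  euclidean_closed A -> euclidean_closed B -> euclidean_closed (A `|` B).
Proof. exact: closedU. Qed.

Lemma constructible_closedI A B : constructible_closed A ->
  constructible_closed B -> constructible_closed (A `&` B).
Proof.
move=> [clA cA] [clB cB].
by split; [exact: euclidean_closedI|exact: constructibleI].
Qed.

Lemma constructible_closed0 : constructible_closed (set0 : set V).
Proof.
split; first exact: closed0.
by exists set0; split=> //; rewrite bigcup_set0.
Qed.

(** Locally closed sets of the constructible topology.  They include the parts
    of a bundle that lie over open sets of the base, and are stable under the
    constructions of the proof. *)
Definition constructible_locally_closed A : Prop := exists A0 C0,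
  [/\ constructible_closed A0, constructible_closed C0 & A = A0 `&` ~` C0].

Lemma constructible_locally_closed_constructible A :
  constructible_locally_closed A -> constructible A.
Proof.
move=> [A0 [C0 [[_ cA0] [_ cC0] ->]]].
by apply: constructibleI => //; exact: constructibleC.
Qed.

Lemma constructible_closed_locally_closed A :
  constructible_closed A -> constructible_locally_closed A.
Proof.
move=> clA; exists A, set0; split=> //; first exact: constructible_closed0.
by rewrite setC0 setIT.
Qed.

(** The set [A `&` D] need not be closed when [A] is only locally closed.
    Adding the part [C0] that was removed from the closed set [A0] closes it,
    and does not change its trace on [A]. *)
Lemma constructible_closed_trace A D : constructible_locally_closed A ->
  euclidean_closed D -> constructible (A `&` D) ->
  exists2 C, constructible_closed C & A `&` D = A `&` C.
Proof.
move=> [A0 [C0 [[clA0 cA0] [clC0 cC0] AE]]] clD cD.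
have CE : (A `&` D) `|` (A0 `&` C0) = A0 `&` (D `|` C0).
  rewrite AE; apply/seteqP; split=> x.
    by move=> [[[A0x _] Dx]|[A0x C0x]]; split=> //; [left|right].
  move=> [A0x]; have [C0x _|nC0x] := pselect (C0 x); first by right.
  by case=> // Dx; left.
exists ((A `&` D) `|` (A0 `&` C0)); first split.
- by rewrite CE; apply: euclidean_closedI => //; exact: euclidean_closedU.
- by apply: constructibleU; last exact: constructibleI.
- rewrite setIUr setIA setIid -[LHS]setU0; congr (_ `|` _).
  by rewrite AE; apply/seteqP; split=> // x [[_ nC0] [_ C0x]]; exact: nC0.
Qed.

Lemma zero_constructible A f SS : stratification A SS -> strat_regular SS f ->
  constructible (A `&` [set x | f x = 0]).
Proof.
move=> [finS lcS _ AE] rf.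
exists [set S `&` [set x | f x = 0] | S in SS]; split.
- exact: finite_image.
- move=> _ [S SS_S <-]; have [C clC SC] := regular_on_zero (rf S SS_S).
  rewrite SC; apply: locally_closedI; first exact: lcS.
  exact: zariski_closed_locally_closed.
- rewrite -AE; apply/seteqP; split=> x.
    move=> [[S SS_S Sx] fx]; exists (S `&` [set x | f x = 0]) => //.
    by exists S.
  by move=> [_ [S SS_S <-] [Sx fx]]; split=> //; exists S.
Qed.

Lemma regulous_on_zero A f : constructible_locally_closed A -> regulous_on A f ->
  exists2 C, constructible_closed C & A `&` [set x | f x = 0] = A `&` C.
Proof.
move=> lcA [cf [SS stA rf]]; have [D clD AD] := cont_on_zero cf.
rewrite AD; apply: constructible_closed_trace => //; rewrite -AD.
exact: zero_constructible stA rf.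
Qed.

Lemma constructible_closed_zero A f : constructible_closed A ->
  regulous_on A f -> constructible_closed (A `&` [set x | f x = 0]).
Proof.
move=> clA /(regulous_on_zero (constructible_closed_locally_closed clA)).
by move=> [C clC ->]; exact: constructible_closedI.
Qed.

Lemma constructible_closedU A B : constructible_closed A ->
  constructible_closed B -> constructible_closed (A `|` B).
Proof.
move=> [clA cA] [clB cB].
by split; [exact: euclidean_closedU|exact: constructibleU].
Qed.

Lemma constructible_locally_closedI A B : constructible_locally_closed A ->
  constructible_locally_closed B -> constructible_locally_closed (A `&` B).
Proof.
move=> [A0 [C0 [clA0 clC0 ->]]] [B0 [D0 [clB0 clD0 ->]]].
exists (A0 `&` B0), (C0 `|` D0); split; first exact: constructible_closedI.
  exact: constructible_closedU.
by rewrite setCU setIACA.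
Qed.

Lemma constructible_locally_closed_open_in A U :
  constructible_locally_closed A -> open_in (@constructible_open R V) A U ->
  constructible_locally_closed U.
Proof.
move=> [A0 [C0 [clA0 clC0 ->]]] [ O opO ->].
exists A0, (C0 `|` ~` O); split=> //; first exact: constructible_closedU.
by rewrite setCU setCK setIA.
Qed.

(** Each function comes with its own stratification; they are refined one
    after the other. *)
Lemma regulous_on_common A (I : finType) (f : I -> V -> R) : constructible A ->
  (forall i, regulous_on A (f i)) ->
  exists2 SS, stratification A SS &
    forall i, (cont_on A `&` strat_regular SS) (f i).
Proof.
move=> cA rf; suff [SS stA rSS] : exists2 SS, stratification A SS &
    forall i, i \in enum I -> strat_regular SS (f i).
  by exists SS => // i; split; [case: (rf i)|apply: rSS; rewrite mem_enum].
elim: (enum I) => [|i s [SS stA rSS]].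
  by have [SS stA] := constructible_stratifiable cA; exists SS.
have [_ [TT stT rT]] := rf i; exists (refinement SS TT id).
  rewrite -[A]setIid.
  by apply: stratification_refinement => // k j; exact: strat_regular_coord.
move=> j; rewrite inE => /orP[/eqP->|js] _ [S SS_S [T TT_T <-]].
  by apply: (regular_onS (B := T)); [move=> x []|exact: rT].
by apply: (regular_onS (B := S)); [move=> x []|exact: rSS].
Qed.

End Strata.

Section Morphisms.
Variables (R : realType) (V W : affineVariety R).
Implicit Types (A : set V) (B C : set W) (h : V -> W).

Lemma preimage_constructible_closed A SS h C : constructible_locally_closed A ->
  stratification A SS -> coords_in (cont_on A `&` strat_regular SS) h ->
  constructible_closed C ->
  exists2 C', constructible_closed C' & A `&` h @^-1` C = A `&` C'.
Proof.
move=> lcA stA Kh [clC cC].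
have ch : {within (A : set (euclidean V)), continuous (h : euclidean V -> euclidean W)}.
  apply: (continuous_comp_initial (X := subspace _)).
  by apply/(continuous_coordP (T := euclidean V)) => i j; exact: (Kh i j).1.
have [D clD AD] := within_continuous_preimage_closed ch clC.
rewrite AD; apply: constructible_closed_trace => //; rewrite -AD.
have [TT stC] := constructible_stratifiable cC.
apply: stratification_constructible.
apply: (stratification_refinement stA stC (h := h)).
by move=> i j; exact: (Kh i j).2.
Qed.

Lemma open_in_preimage (clV : set V -> Prop) (clW : set W -> Prop) A B h U :
  (forall x, A x -> B (h x)) ->
  (forall C, clW C -> exists2 C', clV C' & A `&` h @^-1` C = A `&` C') ->
  (exists2 U0, clW (~` U0) & U = B `&` U0) ->
  exists2 U', clV (~` U') & A `&` h @^-1` U = A `&` U'.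
Proof.
move=> AB pre [U0 clU0 ->]; have [C' clC' AC'] := pre _ clU0.
have /seteqP[s1 s2] := AC'; exists (~` C'); first by rewrite setCK.
apply/seteqP; split=> x [Ax].
  by move=> [_ Ux]; split=> // C'x; have [_] := s2 x (conj Ax C'x).
move=> nC'; split=> //; split; first exact: AB.
by apply: contrapT => nU; apply: nC'; have [] := s1 x (conj Ax nU).
Qed.

(** A morphism of locally ringed spaces into a subset of an affine space amounts
    to its coordinate functions, in both directions.  This is used for regular
    and for regulous maps. *)
Lemma regular_map_of_coords A B h : (forall x, A x -> B (h x)) ->
  coords_in (@regular_on R V A) h -> regular_map A B h.
Proof.
move=> AB rh; split=> // U Uo; split.
  apply: open_in_preimage Uo => //.
  by move=> C; exact: preimage_zariski_closed.
by move=> g; exact: regular_on_comp.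
Qed.

Lemma regulous_map_of_coords A B SS h : (forall x, A x -> B (h x)) ->
  constructible_locally_closed A -> stratification A SS ->
  coords_in (cont_on A `&` strat_regular SS) h -> regulous_map A B h.
Proof.
move=> AB lcA stA Kh; split=> // U Uo; split.
  apply: open_in_preimage Uo => //.
  by move=> C; exact: preimage_constructible_closed Kh.
by move=> g rg; exact: (regulous_on_comp stA Kh rg).
Qed.

Lemma open_in_whole (op : set W -> Prop) B : op setT -> open_in op B B.
Proof. by move=> opT; exists setT; rewrite ?setIT. Qed.

Lemma regular_map_coords A B h :
  regular_map A B h -> coords_in (@regular_on R V A) h.
Proof.
move=> [AB mor] i j; have [_] := mor B (open_in_whole B (zariski_openT W)).
by move=> /(_ _ (@regular_on_coord R W B i j)); rewrite setIidl.
Qed.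

Lemma constructible_openT : constructible_open (setT : set W).
Proof. by rewrite /constructible_open setCT; exact: constructible_closed0. Qed.

(** The coordinate functions are sections over [B] as soon as [B] has some
    stratification, whence the constructibility of [B]. *)
Lemma regulous_map_coords A B h : constructible B ->
  regulous_map A B h -> coords_in (regulous_on A) h.
Proof.
move=> cB [AB mor] i j; have [_] := mor B (open_in_whole B constructible_openT).
have [SS stB] := constructible_stratifiable cB.
move=> /(_ (fun y => av_emb y i j)); rewrite setIidl//; apply.
split; first exact: cont_on_coord.
by exists SS => //; exact: strat_regular_coord.
Qed.

End Morphisms.

Section ProductCoordinates.
Variables (R : realType) (V : affineVariety R) (F : scalar_kind) (n : nat).
Local Notation P := (prod_variety V F n).

Lemma coords_in_prod (W : affineVariety R) (K : set (W -> R)) (h : W -> P) :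
  coords_in K (fun x => (h x).1) -> mx_class K (fun x => real_coords (h x).2) ->
  coords_in K h.
Proof.
move=> K1 K2 i j; rewrite /av_emb /= /prod_emb.
case: (splitP j) => k jk.
  have -> : j = lshift _ k by exact: val_inj.
  suff -> : (fun x => row_mx (av_emb (h x).1) (real_coords (h x).2) i (lshift _ k)) =
    (fun x => av_emb (h x).1 i k) by exact: K1.
  by apply/funext => x; rewrite row_mxEl.
have -> : j = rshift _ k by exact: val_inj.
suff -> : (fun x => row_mx (av_emb (h x).1) (real_coords (h x).2) i (rshift _ k)) =
    (fun x => real_coords (h x).2 i k) by exact: K2.
by apply/funext => x; rewrite row_mxEr.
Qed.

Lemma coords_in_fst (W : affineVariety R) (K : set (W -> R)) (h : W -> P) :
  coords_in K h -> coords_in K (fun x => (h x).1).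
Proof.
move=> Kh i j; have := Kh i (lshift _ j).
congr K; apply/funext => x; by rewrite /av_emb /= /prod_emb row_mxEl.
Qed.

Lemma coords_in_snd (W : affineVariety R) (K : set (W -> R)) (h : W -> P) :
  coords_in K h -> mx_class K (fun x => real_coords (h x).2).
Proof.
move=> Kh i j; have := Kh i (rshift _ j).
congr K; apply/funext => x; by rewrite /av_emb /= /prod_emb row_mxEr.
Qed.

End ProductCoordinates.

(** * The continuous, regular and regulous geometries *)

(** The features shared by continuous, regular and regulous maps on which the
    construction of trivializations relies.  The sets on which the functions
    of a geometry behave well are the [good] ones: a regulous function needs a
    stratification of its domain, and its zero set is the trace of a closed set
    when the domain is locally closed. *)
Record geometry (R : realType) (op : open_kind R) (mor : map_kind R)
    (K : sheaf_kind R) (good : forall V : affineVariety R, set V -> Prop) :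
    Prop := Geometry {
  geo_class : forall (V : affineVariety R) (A : set V),
    good V A -> function_class A (K V A);
  geo_coord : forall (V : affineVariety R) (A : set V) i j,
    good V A -> K V A (fun x => av_emb x i j);
  geo_comp : forall (V W : affineVariety R) (A : set V) (B : set W) h g,
    good V A -> coords_in (K V A) h -> K W B g ->
    K V (A `&` h @^-1` B) (g \o h);
  geo_mor : forall (V W : affineVariety R) (A : set V) (B : set W) h,
    good V A -> good W B ->
    (mor V W A B h <-> (forall x, A x -> B (h x)) /\ coords_in (K V A) h);
  geo_nonzero : forall (V : affineVariety R) (A : set V) f,
    good V A -> K V A f -> open_in (@op V) A (A `&` [set x | f x != 0]);
  geo_open : forall (V : affineVariety R) (A U : set V),
    good V A -> open_in (@op V) A U -> good V U;
  geo_I : forall (V : affineVariety R) (A B : set V),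
    good V A -> good V B -> good V (A `&` B);
  geo_prod : forall (V : affineVariety R) F n (A : set V),
    good V A -> good _ (prod_over F n A) }.

Section Geometries.
Variable R : realType.

Definition any_set (V : affineVariety R) (A : set V) : Prop := True.

Lemma setI_nonzero (V : affineVariety R) (A C : set V) (f : V -> R) :
  A `&` [set x | f x = 0] = A `&` C ->
  A `&` [set x | f x != 0] = A `&` ~` C.
Proof.
move=> /seteqP[s1 s2]; apply/seteqP; split=> x [Ax fx]; split=> //.
  by move=> Cx; have [_ /eqP] := s2 x (conj Ax Cx); rewrite (negbTE fx).
by apply/eqP => /= f0; apply: fx; have [] := s1 x (conj Ax f0).
Qed.

Lemma continuous_geometry :
  geometry (@euclidean_open R) (@continuous_map R) (@cont_on R) any_set.
Proof.
split=> //.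
- by move=> V A _; exact: function_class_cont_on.
- by move=> V A i j _; exact: cont_on_coord.
- by move=> V W A B h g _; exact: cont_on_comp.
- by move=> V W A B h _ _; exact: continuous_map_coords.
- move=> V A f _ /cont_on_zero[C clC /setI_nonzero AC].
  by exists (~` C) => //; exact: closed_openC.
Qed.

Lemma regular_geometry :
  geometry (@zariski_open R) (@regular_map R) (@regular_on R) any_set.
Proof.
split=> //.
- by move=> V A _; exact: function_class_regular.
- by move=> V A i j _; exact: regular_on_coord.
- by move=> V W A B h g _; exact: regular_on_comp.
- move=> V W A B h _ _; split=> [mor|[AB rh]].
    by split; [case: mor|exact: regular_map_coords mor].
  exact: regular_map_of_coords.
- move=> V A f _ /regular_on_zero[C clC /setI_nonzero AC].
  by exists (~` C) => //; exact: zariski_open_closedC.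
Qed.

Lemma regulous_coords_common (V W : affineVariety R) (A : set V) (h : V -> W) :
  constructible A -> coords_in (regulous_on A) h ->
  exists2 SS, stratification A SS &
    coords_in (cont_on A `&` strat_regular SS) h.
Proof.
move=> cA rh.
have [SS stA Kh] := regulous_on_common (I := 'I_(av_dim W)) cA (rh 0).
by exists SS => // i j; rewrite ord1.
Qed.

(** The product is a preimage under the projection, which has polynomial
    coordinates. *)
Lemma constructible_closed_prod (V : affineVariety R) F n (A : set V) :
  constructible_closed A -> constructible_closed (prod_over F n A).
Proof.
move=> clA; have clT : constructible_closed (setT : set (prod_variety V F n)).
  split; first exact: closedT.
  exact/(constructible_of_lc)/zariski_closed_locally_closed/zariski_closedT.
have [SS stT] := constructible_stratifiable clT.2.
have K1 : coords_in (cont_on setT `&` strat_regular SS)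
    (fst : prod_variety V F n -> V).
  apply: (coords_in_fst (h := id)) => i j.
  by split; [exact: cont_on_coord|exact: strat_regular_coord].
have [C clC TC] := preimage_constructible_closed
  (constructible_closed_locally_closed clT) stT K1 clA.
have -> // : prod_over F n A = C.
rewrite -[RHS]setTI -TC setTI.
by apply/seteqP; split=> [[x w] []|[x w]].
Qed.

Lemma regulous_geometry : geometry (@constructible_open R) (@regulous_map R)
  (@regulous_on R) (@constructible_locally_closed R).
Proof.
split.
- move=> V A /constructible_locally_closed_constructible.
  exact: function_class_regulous.
- move=> V A i j /constructible_locally_closed_constructible.
  move=> /constructible_stratifiable[SS stA]; split; first exact: cont_on_coord.
  by exists SS => //; exact: strat_regular_coord.
- move=> V W A B h g /constructible_locally_closed_constructible cA.
  move=> /(regulous_coords_common cA)[SS stA Kh].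
  exact: regulous_on_comp stA Kh.
- move=> V W A B h lcA /constructible_locally_closed_constructible cB.
  split=> [mor|[AB rh]].
    by split; [case: mor|exact: regulous_map_coords mor].
  have [SS stA Kh] := regulous_coords_common
    (constructible_locally_closed_constructible lcA) rh.
  exact: regulous_map_of_coords stA Kh.
- move=> V A f lcA /(regulous_on_zero lcA)[C clC /setI_nonzero AC].
  by exists (~` C) => //; rewrite /constructible_open setCK.
- exact: constructible_locally_closed_open_in.
- exact: constructible_locally_closedI.
- move=> V F n A [A0 [C0 [clA0 clC0 ->]]].
  exists (prod_over F n A0), (prod_over F n C0); split.
  + exact: constructible_closed_prod.
  + exact: constructible_closed_prod.
  + apply/seteqP; split=> [[x w] [[A0x nC0] _]|[x w] [[A0x _] nC0]].
      by split=> // -[].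
    by split=> //; split=> // C0x; exact: nC0.
Qed.

End Geometries.

(** * Real coordinates of F-linear maps *)

Section RealCoordinates.
Variables (R : realType) (F : scalar_kind).
Local Notation FF := (scalar_ring R F).

Lemma real_linear_mx m p (f : 'rV[R]_m -> 'rV[R]_p) :
  (forall c u v, f (c *: u + v) = c *: f u + f v) ->
  exists M : 'M[R]_(m, p), forall u, u *m M = f u.
Proof.
move=> lin_f.
pose g : {linear 'rV[R]_m -> 'rV[R]_p} :=
  HB.pack f (GRing.isLinear.Build R 'rV[R]_m 'rV[R]_p *:%R f lin_f).
by exists (lin1_mx g) => u; rewrite mul_rV_lin1.
Qed.

Lemma eq_mx_rV m p (A B : 'M[R]_(m, p)) :
  (forall u : 'rV[R]_m, u *m A = u *m B) -> A = B.
Proof. by move=> AB; apply/row_matrixP => i; rewrite !rowE AB. Qed.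

Lemma scalar_coordsD (x y : FF) j :
  (scalar_coords (x + y))`_j = (scalar_coords x)`_j + (scalar_coords y)`_j.
Proof.
case: F x y => //=.
- by case: j => [|j] x y //=; rewrite nth_nil addr0.
- by case: j => [|[|j]] [a b] [c d] //=; rewrite nth_nil addr0.
- by case: j => [|[|[|[|j]]]] x y //=; rewrite nth_nil addr0.
Qed.

(** The real numbers inside [F]. *)
Definition real_scalar (c : R) : FF :=
  scalar_of_coords F (fun k => if k == 0%N then c else 0).

Lemma scalar_coordsZ c (x : FF) j :
  (scalar_coords (real_scalar c * x))`_j = c * (scalar_coords x)`_j.
Proof.
rewrite /real_scalar; case: F x => //=.
- by case: j => [|j] x //=; rewrite nth_nil mulr0.
- by case: j => [|[|j]] [a b] //=; rewrite ?nth_nil ?mulr0 // !mul0r ?subr0 ?addr0.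
- case: j => [|[|[|[|j]]]] [a b d e] //=; rewrite ?nth_nil ?mulr0 //; ring.
Qed.

(** The adjoint of a multiplication is the multiplication by the conjugate. *)
Lemma scalar_adjoint (a : FF) : exists b : FF, forall x y : FF,
  \sum_(j < real_dim F) (scalar_coords (a * x))`_j * (scalar_coords y)`_j =
  \sum_(j < real_dim F) (scalar_coords x)`_j * (scalar_coords (b * y))`_j.
Proof.
case: F a => /=.
- by move=> a; exists a => x y; rewrite !big_ord_recl !big_ord0 /=; ring.
- move=> [a b]; exists (complex.Complex a (- b)) => -[x x'] [y y'].
  by rewrite !big_ord_recl !big_ord0 /=; ring.
- move=> [a b c d]; exists (Quaternion a (- b) (- c) (- d)) => -[x x' x'' x'''].
  by move=> [y y' y'' y''']; rewrite !big_ord_recl !big_ord0 /=; ring.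
Qed.

Section Dimension.
Variable n : nat.
Local Notation N := (n * real_dim F)%N.
Implicit Types (w : 'rV[FF]_n) (v : 'rV[R]_N).

Definition of_real_coords v : 'rV[FF]_n := projT1 (cid (real_coords_surj v)).

Lemma of_real_coordsK v : real_coords (of_real_coords v) = v.
Proof. by rewrite /of_real_coords; case: cid. Qed.

Lemma real_coordsK w : of_real_coords (real_coords w) = w.
Proof. by apply: real_coords_inj; rewrite of_real_coordsK. Qed.

Lemma real_coordsD w w' : real_coords (w + w') = real_coords w + real_coords w'.
Proof.
rewrite /real_coords -linearD; congr mxvec; apply/matrixP => i j.
by rewrite !mxE scalar_coordsD.
Qed.

Lemma real_coordsZ c w : real_coords (real_scalar c *: w) = c *: real_coords w.
Proof.
rewrite /real_coords -linearZ; congr mxvec; apply/matrixP => i j.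
by rewrite !mxE scalar_coordsZ.
Qed.

Lemma of_real_coords_lin c v v' : of_real_coords (c *: v + v') =
  real_scalar c *: of_real_coords v + of_real_coords v'.
Proof.
apply: real_coords_inj.
by rewrite real_coordsD real_coordsZ !of_real_coordsK.
Qed.

Lemma real_coords_dot w w' : (real_coords w *m (real_coords w')^T) 0 0 =
  \sum_(i < n) \sum_(j < real_dim F)
     (scalar_coords (w 0 i))`_j * (scalar_coords (w' 0 i))`_j.
Proof.
rewrite mxE pair_bigA /= (reindex _ (curry_mxvec_bij n (real_dim F))) /=.
by apply: eq_bigr => -[i j] _; rewrite !mxE /real_coords !mxvecE !mxE.
Qed.

Lemma scal_mx_exists (a : FF) : exists M : 'M[R]_N,
  forall v, v *m M = real_coords (a *: of_real_coords v).
Proof.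
apply: real_linear_mx => c u v.
rewrite of_real_coords_lin scalerDr real_coordsD -real_coordsZ !scalerA.
congr (real_coords _ + _); congr (_ *: _).
rewrite /real_scalar; case: F a => /=.
- by move=> a; rewrite mulrC.
- by move=> [a b]; congr complex.Complex; rewrite /=; ring.
- by move=> [x y z t]; congr Quaternion; rewrite /=; ring.
Qed.

(** Matrices act on row vectors, hence on the right, while scalars act on the
    left. *)
Definition scal_mx (a : FF) : 'M[R]_N := projT1 (cid (scal_mx_exists a)).

Lemma mul_scal_mx a w :
  real_coords w *m scal_mx a = real_coords (a *: w).
Proof. by rewrite /scal_mx; case: cid => M /= ->; rewrite real_coordsK. Qed.

Lemma scal_mx_adjoint (a : FF) : exists b, (scal_mx a)^T = scal_mx b.
Proof.
have [b ab] := scalar_adjoint a; exists b; apply: eq_mx_rV => u.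
rewrite -(of_real_coordsK u) mul_scal_mx; set y := of_real_coords u.
apply/rowP => k.
have dot (v : 'rV[R]_N) : v 0 k =
    (real_coords (of_real_coords (delta_mx 0 k)) *m v^T) 0 0.
  by rewrite of_real_coordsK -rowE !mxE.
rewrite [LHS]dot [RHS]dot trmx_mul trmxK mulmxA mul_scal_mx !real_coords_dot.
by apply: eq_bigr => i _; rewrite !mxE ab.
Qed.

End Dimension.

(** Maps between powers of [F] are handled as real matrices, for which
    determinants exist even when [F] is not commutative.  Linearity over [F] is
    then commutation with the scalars. *)
Definition F_linear_mx n r (M : 'M[R]_(n * real_dim F, r * real_dim F)) : Prop :=
  forall a : FF, scal_mx n a *m M = M *m scal_mx r a.

Lemma F_linear_mxP n r (M : 'M[R]_(n * real_dim F, r * real_dim F)) :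
  F_linear_mx M -> forall a (u v : 'rV[FF]_n),
  of_real_coords (real_coords (a *: u + v) *m M) =
  a *: of_real_coords (real_coords u *m M) + of_real_coords (real_coords v *m M).
Proof.
move=> FM a u v; apply: real_coords_inj.
by rewrite !real_coordsD -!mul_scal_mx !of_real_coordsK mulmxDl -!mulmxA FM.
Qed.

Lemma F_linear_mx_of n r (f : 'rV[FF]_n -> 'rV[FF]_r) :
  (forall a u v, f (a *: u + v) = a *: f u + f v) ->
  exists2 M, F_linear_mx M &
    forall u, real_coords u *m M = real_coords (f u).
Proof.
move=> lin_f.
have [M fM] : exists M, forall v, v *m M = real_coords (f (of_real_coords v)).
  apply: real_linear_mx => c u v.
  by rewrite of_real_coords_lin lin_f real_coordsD real_coordsZ.
have f0 : f 0 = 0.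
  have := lin_f 1 0 0; rewrite !scale1r addr0 => /eqP.
  by rewrite -{1}[f 0]addr0 (inj_eq (addrI _)) eq_sym => /eqP.
have MfE u : real_coords u *m M = real_coords (f u) by rewrite fM real_coordsK.
exists M => // a; apply: eq_mx_rV => v; rewrite -(of_real_coordsK v) !mulmxA.
rewrite mul_scal_mx !MfE mul_scal_mx; congr real_coords.
by rewrite -[a *: _ in LHS]addr0 lin_f f0 addr0.
Qed.

Section FLinearAlgebra.
Variables n r s : nat.

Lemma F_linear_mxM (M : 'M[R]_(n * real_dim F, r * real_dim F))
    (M' : 'M[R]_(r * real_dim F, s * real_dim F)) :
  F_linear_mx M -> F_linear_mx M' -> F_linear_mx (M *m M').
Proof. by move=> FM FM' a; rewrite mulmxA FM -mulmxA FM' mulmxA. Qed.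

Lemma F_linear_mxD (M M' : 'M[R]_(n * real_dim F, r * real_dim F)) :
  F_linear_mx M -> F_linear_mx M' -> F_linear_mx (M + M').
Proof. by move=> FM FM' a; rewrite mulmxDl mulmxDr FM FM'. Qed.

Lemma F_linear_mxN (M : 'M[R]_(n * real_dim F, r * real_dim F)) :
  F_linear_mx M -> F_linear_mx (- M).
Proof. by move=> FM a; rewrite mulmxN mulNmx FM. Qed.

Lemma F_linear_mx1 : F_linear_mx (1%:M : 'M[R]_(n * real_dim F)).
Proof. by move=> a; rewrite mul1mx mulmx1. Qed.

Lemma F_linear_mxV (M : 'M[R]_(n * real_dim F)) :
  M \in unitmx -> F_linear_mx M -> F_linear_mx (invmx M).
Proof.
move=> uM FM a; apply: (can_inj (mulKmx uM)).
by rewrite mulmxA -FM -mulmxA mulmxV// mulmx1 mulmxA mulmxV// mul1mx.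
Qed.

End FLinearAlgebra.

End RealCoordinates.

(** * Orthogonal projectors *)

Section OrthogonalProjector.
Variables (R : realType) (F : scalar_kind) (n : nat).
Local Notation FF := (scalar_ring R F).
Local Notation N := (n * real_dim F)%N.
Implicit Types (W : set 'rV[FF]_n) (P Q : 'M[R]_N).

Lemma subspace_lin W : vector_subspace W ->
  forall a u v, W u -> W v -> W (a *: u + v).
Proof.
by move=> [_ lin] a u v /mem_set Wu /mem_set Wv; apply/set_mem; exact: lin.
Qed.

Lemma subspace0 W : vector_subspace W -> W 0.
Proof. by move=> [W0 _]; exact/set_mem. Qed.

Lemma subspaceZ W : vector_subspace W -> forall a u, W u -> W (a *: u).
Proof.
by move=> sW a u Wu; rewrite -[_ *: _]addr0; apply: subspace_lin => //; exact: subspace0.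
Qed.

Definition orth_proj W P : Prop :=
  [/\ P^T = P, P *m P = P &
      forall w, W w <-> real_coords w *m P = real_coords w].

Lemma orth_proj_fix W P v : orth_proj W P ->
  W (of_real_coords v) <-> v *m P = v.
Proof. by move=> [_ _ ->]; rewrite of_real_coordsK. Qed.

(** The rows of [P] belong to the image of [W], and [Q] fixes that image. *)
Lemma orth_proj_mul W P Q : orth_proj W P -> orth_proj W Q -> P *m Q = P.
Proof.
move=> oP oQ; apply: eq_mx_rV => u; rewrite mulmxA.
apply/(orth_proj_fix _ oQ)/(orth_proj_fix _ oP).
by rewrite -mulmxA; case: oP => _ ->.
Qed.

(** Transposing [Q P = Q] gives [P Q = Q], while [P Q = P]. *)
Lemma orth_proj_unique W P Q : orth_proj W P -> orth_proj W Q -> P = Q.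
Proof.
move=> oP oQ; rewrite -(orth_proj_mul oP oQ).
have := congr1 trmx (orth_proj_mul oQ oP); rewrite trmx_mul.
by case: oP => -> _ _; case: oQ => -> _ _.
Qed.

(** With [s] the matrix of a scalar, [P s P = P s] because [W] is stable under
    the scalars.  The transposed relation [P s P = s P] also holds, because the
    adjoint of a scalar is a scalar. *)
Lemma orth_proj_F_linear W P : vector_subspace W -> orth_proj W P ->
  F_linear_mx (P : 'M[R]_(n * real_dim F, n * real_dim F)).
Proof.
move=> sW oP; have [sP PP _] := oP.
have stab a : P *m scal_mx n a *m P = P *m scal_mx n a.
  apply: eq_mx_rV => u; rewrite mulmxA; apply/(orth_proj_fix _ oP).
  rewrite mulmxA -(of_real_coordsK (u *m P)) mul_scal_mx real_coordsK.
  by apply: subspaceZ => //; apply/(orth_proj_fix _ oP); rewrite -mulmxA PP.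
move=> a; have [b ab] := scal_mx_adjoint n a; have := congr1 trmx (stab b).
by rewrite !trmx_mul -ab !trmxK sP mulmxA stab => ->.
Qed.

Lemma dot_eq0 m (u : 'rV[R]_m) : u *m u^T = 0 -> u = 0.
Proof.
move=> /matrixP/(_ 0 0); rewrite !mxE => /eqP.
rewrite psumr_eq0 => [/allP u0|i _]; last by rewrite mxE -expr2 sqr_ge0.
apply/rowP => i; rewrite mxE; have := u0 i (mem_index_enum i).
by rewrite mxE mulf_eq0 orbb => /eqP.
Qed.

(** The solution of the normal equations for the row space of [B]. *)
Definition gram_proj k (B : 'M[R]_(k, N)) : 'M[R]_N :=
  B^T *m invmx (B *m B^T) *m B.

Lemma gram_unit k (B : 'M[R]_(k, N)) :
  (forall c : 'rV_k, c *m B = 0 -> c = 0) -> B *m B^T \in unitmx.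
Proof.
move=> injB; rewrite -row_free_unit; apply: inj_row_free => c cB.
apply: injB; apply: dot_eq0.
by rewrite trmx_mul mulmxA -[c *m B *m _]mulmxA cB mul0mx.
Qed.

Lemma gram_orth_proj k (B : 'M[R]_(k, N)) W :
  (forall c : 'rV_k, c *m B = 0 -> c = 0) ->
  (forall w, W w <-> exists c, real_coords w = c *m B) ->
  orth_proj W (gram_proj B).
Proof.
move=> injB WB; have uG := gram_unit injB; split.
- by rewrite /gram_proj !trmx_mul trmx_inv trmx_mul !trmxK mulmxA.
- by rewrite /gram_proj !mulmxA -[_ *m B *m B^T]mulmxA mulmxKV.
- move=> w; rewrite WB; split=> [[c ->]|wP].
    by rewrite /gram_proj !mulmxA -[_ *m B *m B^T]mulmxA mulmxK.
  exists (real_coords w *m B^T *m invmx (B *m B^T)).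
  by rewrite -[LHS]wP /gram_proj !mulmxA.
Qed.

End OrthogonalProjector.

Section BundleProjector.
Variables (R : realType) (V : affineVariety R) (F : scalar_kind) (n : nat).
Local Notation FF := (scalar_ring R F).
Implicit Types (E : set (prod_variety V F n)) (x : V).

(** The value [0] is taken only at points where no projector exists. *)
Definition bundle_proj E x : 'M[R]_(n * real_dim F) :=
  xget 0 [set P | orth_proj (fiber E x) P].

Lemma bundle_proj_eq E x P : orth_proj (fiber E x) P -> bundle_proj E x = P.
Proof.
move=> oP; apply: (orth_proj_unique _ oP).
have : exists Q, [set P | orth_proj (fiber E x) P] Q by exists P.
by move=> /(xgetPex 0).
Qed.

(** The map [f] is constrained only on [W], because a trivialization is
    arbitrary outside the bundle. *)
Definition linear_chart r (W : set 'rV[FF]_n) (f : 'rV[FF]_n -> 'rV[FF]_r)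
    (g : 'rV[FF]_r -> 'rV[FF]_n) : Prop :=
  [/\ forall a u v, W u -> W v -> f (a *: u + v) = a *: f u + f v,
      forall a c d, g (a *: c + d) = a *: g c + g d,
      forall c, W (g c), forall c, f (g c) = c & forall w, W w -> g (f w) = w].

(** The inverse [k] of a trivialization preserves the base point because [h]
    does so on the bundle. *)
Lemma trivialization_chart r E U (h : prod_variety V F n -> prod_variety V F r) k
    y : vector_subspace (fiber E y) -> U y ->
  (forall z, prod_over F r U z -> restr E U (k z)) ->
  (forall z, restr E U z -> k (h z) = z) ->
  (forall z, prod_over F r U z -> h (k z) = z) ->
  fiberwise_linear_iso E U h ->
  (forall c, (k (y, c)).1 = y) /\
  linear_chart (fiber E y) (fun w => (h (y, w)).2) (fun c => (k (y, c)).2).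
Proof.
move=> sE Uy kE kh hk lin_h; have [h1 h2 [_ inj_h _]] := lin_h y Uy.
have k1 c : (k (y, c)).1 = y.
  have Uyc : prod_over F r U (y, c) by [].
  have [Ez [Uz _]] := kE _ Uyc; have := hk _ Uyc.
  case: (k (y, c)) Ez Uz => z w /= Ez Uz hzw.
  by have [/(_ w Ez)] := lin_h z Uz; rewrite hzw.
have kyE c : k (y, c) = (y, (k (y, c)).2) by rewrite -{2}(k1 c) -surjective_pairing.
have Ek c : fiber E y (k (y, c)).2.
  have Uyc : prod_over F r U (y, c) by [].
  by rewrite /fiber /= -kyE; have [] := kE _ Uyc.
have fg c : (h (y, (k (y, c)).2)).2 = c by rewrite -kyE hk.
split=> //; split=> //.
- move=> a c d; apply: inj_h; rewrite ?inE //.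
    by apply: subspace_lin.
  by rewrite fg h2 // !fg.
- move=> w Ew; have Eyw : restr E U (y, w) by [].
  have := kh _ Eyw; rewrite [h (y, w)]surjective_pairing h1 //=.
  by move=> ->.
Qed.

(** The chart is extended to all vectors by precomposition with the projector;
    it then becomes the linear map of matrix [Phi]. *)
Lemma chart_matrices r W f g P : vector_subspace W -> orth_proj W P ->
  @linear_chart r W f g -> exists Phi Psi,
  [/\ F_linear_mx (Phi : 'M[R]_(n * real_dim F, r * real_dim F)),
      F_linear_mx (Psi : 'M[R]_(r * real_dim F, n * real_dim F)),
      Phi *m Psi = P /\ Psi *m Phi = 1%:M, Psi *m P = Psi /\ P *m Phi = Phi &
      forall c, real_coords (g c) = real_coords c *m Psi].
Proof.
move=> sW oP [lin_f lin_g Wg fg gf]; have [_ PP _] := oP.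
have FP := orth_proj_F_linear sW oP.
pose p (w : 'rV[FF]_n) := of_real_coords (real_coords w *m P).
have Wp w : W (p w) by apply/(orth_proj_fix _ oP); rewrite -mulmxA PP.
have lin_fp a u v : f (p (a *: u + v)) = a *: f (p u) + f (p v).
  by rewrite /p F_linear_mxP // lin_f //; exact: Wp.
have [Phi FPhi PhiE] := F_linear_mx_of lin_fp.
have [Psi FPsi PsiE] := F_linear_mx_of lin_g.
have pW w : W w -> p w = w.
  move=> Ww; rewrite /p; have [_ _ /(_ w)[-> //]] := oP.
  by rewrite real_coordsK.
have pp w : p (p w) = p w by exact: pW.
exists Phi, Psi; split=> //; first split.
- apply: eq_mx_rV => v; rewrite -(of_real_coordsK v) mulmxA PhiE PsiE gf //.
  by rewrite /p !of_real_coordsK.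
- apply: eq_mx_rV => c; rewrite -(of_real_coordsK c) mulmxA PsiE PhiE pW // fg.
  by rewrite mulmx1.
- split; apply: eq_mx_rV => v; rewrite -(of_real_coordsK v) mulmxA.
    by rewrite PsiE; have [_ _ /(_ (g (of_real_coords v)))[-> //]] := oP.
  rewrite PhiE -[X in real_coords (f X)]pp -PhiE.
  by rewrite /p !of_real_coordsK.
Qed.

End BundleProjector.

(** * Local triviality in terms of the projector *)

Section BundlesInGeometry.
Variables (R : realType) (op : open_kind R) (mor : map_kind R).
Variables (K : sheaf_kind R) (good : forall V : affineVariety R, set V -> Prop).
Hypothesis geo : geometry op mor K good.
Variables (V : affineVariety R) (F : scalar_kind) (n : nat).
Implicit Types (A U : set V) (E D : set (prod_variety V F n)).

Lemma geo_fst p q U D (M : V -> 'M[R]_(p, q)) : good D ->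
  D `<=` prod_over F n U -> mx_class (K U) M -> mx_class (K D) (fun z => M z.1).
Proof.
move=> gD DU KM i j.
have := geo_comp geo (h := fst : prod_variety V F n -> V) gD _ (KM i j).
rewrite setIidl => [|z /DU[]//]; apply; apply: (coords_in_fst (h := id)) => k l.
exact: (geo_coord geo).
Qed.

(** The real frame obtained by transporting the canonical basis through the
    inverse trivialization has entries in [K]; the projector is its
    [gram_proj]. *)
Lemma trivialization_proj r U E (h : prod_variety V F n -> prod_variety V F r) :
  good U -> good (restr E U) ->
  (forall x, U x -> vector_subspace (fiber E x)) ->
  isomorphism mor (restr E U) (prod_over F r U) h ->
  fiberwise_linear_iso E U h ->
  (forall x, U x -> orth_proj (fiber E x) (bundle_proj E x)) /\
  mx_class (K U) (bundle_proj E).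
Proof.
move=> gU gE sE [k [_ mor_k kh hk]] lin_h.
have gP : good (prod_over F r U) by exact: (geo_prod geo).
have [kE Kk] := (geo_mor geo _ gP gE).1 mor_k.
pose B x := \matrix_(l < r * real_dim F)
  real_coords (k (x, of_real_coords (delta_mx 0 l))).2.
have oB x : U x -> (forall c : 'rV_(r * real_dim F), c *m B x = 0 -> c = 0) /\
    orth_proj (fiber E x) (gram_proj (B x)).
  move=> Ux.
  have [k1 [lin_f lin_g Eg fg gf]] := trivialization_chart (sE x Ux) Ux kE kh hk lin_h.
  have [Psi _ PsiE] := F_linear_mx_of lin_g.
  have BE : B x = Psi.
    by apply/row_matrixP => l; rewrite rowK rowE -PsiE of_real_coordsK.
  have injB (c : 'rV_(r * real_dim F)) : c *m B x = 0 -> c = 0.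
    rewrite BE -(of_real_coordsK c) PsiE => gc0.
    have /real_coords_inj gcE : real_coords (k (x, of_real_coords c)).2 =
      real_coords (k (x, of_real_coords 0)).2.
      by rewrite gc0 -PsiE of_real_coordsK mul0mx.
    by rewrite -[of_real_coords c]fg gcE fg of_real_coordsK.
  split=> //; apply: gram_orth_proj => // w; rewrite BE; split=> [Ew|[c]].
    by exists (real_coords (h (x, w)).2); rewrite PsiE gf.
  by rewrite -(of_real_coordsK c) PsiE => /real_coords_inj->.
split=> [x Ux|].
  have [_ oP] := oB x Ux; rewrite (bundle_proj_eq oP); exact: oP.
have clU := geo_class geo gU.
have KB : mx_class (K U) B.
  move=> l j; pose c : 'rV[scalar_ring R F]_r := of_real_coords (delta_mx 0 l).
  have Kc : coords_in (K U) (fun x : V => (x, c) : prod_variety V F r).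
    apply: coords_in_prod; first by move=> i' j'; exact: (geo_coord geo).
    exact: (mx_class_cst clU (real_coords c)).
  have := geo_comp geo gU Kc (coords_in_snd Kk 0 j).
  rewrite setIidl => [|x Ux //]; apply: (fc_ext clU) => x _.
  by rewrite /= mxE.
apply: (mx_class_ext clU (M := fun x => gram_proj (B x))).
  by move=> x /oB[_ oP]; rewrite (bundle_proj_eq oP).
apply: (mx_classM clU) => //; apply: (mx_classM clU); first exact: (mx_classT clU).
apply: (mx_classV clU).
  by apply: (mx_classM clU) => //; exact: (mx_classT clU).
move=> x /oB[injB _]; rewrite -unitfE -unitmxE; exact: gram_unit.
Qed.

Section Rotation.
Variables (N : nat) (P0 P : 'M[R]_N).
Hypotheses (PP0 : P0 *m P0 = P0) (PP : P *m P = P).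

(** This matrix maps the image of [P0] to that of [P], and the kernel of [P0]
    to that of [P].  It is the identity for [P = P0], hence invertible for [P]
    near [P0]. *)
Definition rotation : 'M[R]_N := P0 *m P + (1%:M - P0) *m (1%:M - P).

Lemma mul_proj_rotation : P0 *m rotation = P0 *m P.
Proof.
have P0C : P0 *m (1%:M - P0) = 0 by rewrite mulmxBr mulmx1 PP0 subrr.
by rewrite /rotation mulmxDr !mulmxA PP0 P0C mul0mx addr0.
Qed.

Lemma mul_rotation_proj : rotation *m P = P0 *m P.
Proof.
have PC : (1%:M - P) *m P = 0 by rewrite mulmxBl mul1mx PP subrr.
by rewrite /rotation mulmxDl -!mulmxA PP PC mulmx0 addr0.
Qed.

Lemma mul_invrotation_proj : rotation \in unitmx ->
  invmx rotation *m P0 = P *m invmx rotation.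
Proof.
move=> uT; apply: (can_inj (mulKmx uT)); rewrite mulKVmx //.
apply: (can_inj (mulmxK uT)); rewrite -!mulmxA mulVmx // mulmx1.
by rewrite mul_rotation_proj mul_proj_rotation.
Qed.

End Rotation.

Lemma rotation_id N (P : 'M[R]_N) : P *m P = P -> rotation P P = 1%:M.
Proof.
move=> PP; rewrite /rotation PP mulmxBr mulmx1 [(1%:M - P) *m P]mulmxBl mul1mx.
by rewrite PP subrr subr0 addrC subrK.
Qed.

(** Over the open set where the [rotation] from the fiber at [x0] is invertible,
    it identifies the fibers with the fiber at [x0], which has a linear chart. *)
Lemma proj_locally_trivial A E : good A -> good E ->
  (forall x, A x -> vector_subspace (fiber E x)) ->
  (forall x, A x -> orth_proj (fiber E x) (bundle_proj E x)) ->
  (forall x, A x -> exists r f g, @linear_chart R F n r (fiber E x) f g) ->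
  mx_class (K A) (bundle_proj E) ->
  locally_trivial op mor A E.
Proof.
move=> gA gE sE oE chE KE x0 Ax0.
have [r [f [g chart0]]] := chE x0 Ax0.
have [Phi [Psi [FPhi FPsi [PhiPsi PsiPhi] [PsiP0 P0Phi] _]]] :=
  chart_matrices (sE _ Ax0) (oE _ Ax0) chart0.
have PP x : A x -> bundle_proj E x *m bundle_proj E x = bundle_proj E x.
  by move=> /oE[].
pose P0 := bundle_proj E x0; pose T x := rotation P0 (bundle_proj E x).
have clA := geo_class geo gA.
have KT : mx_class (K A) T.
  have Kc (M : 'M[R]_(n * real_dim F)) := mx_class_cst clA M.
  apply: (mx_classD clA); apply: (mx_classM clA) => //.
  by apply: (mx_classD clA) => //; exact: (mx_classN clA).
pose U := A `&` [set x | \det (T x) != 0].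
have opU : open_in (@op V) A U by apply: (geo_nonzero geo) => //; exact: (fc_det clA KT).
have gU : good U by exact: (geo_open geo) opU.
have UA : U `<=` A by move=> x [].
have uT x : U x -> T x \in unitmx by move=> [_]; rewrite unitmxE unitfE.
have Ux0 : U x0.
  by split=> //=; rewrite /T rotation_id ?det1 ?oner_eq0 //; exact: PP.
exists U; split=> //; exists r.
have FT x : A x -> F_linear_mx (T x).
  move=> Ax; have F0 := orth_proj_F_linear (sE _ Ax0) (oE _ Ax0).
  have Fx := orth_proj_F_linear (sE _ Ax) (oE _ Ax).
  apply: F_linear_mxD; apply: F_linear_mxM => //.
    by apply: F_linear_mxD; [exact: F_linear_mx1|exact: F_linear_mxN].
  by apply: F_linear_mxD; [exact: F_linear_mx1|exact: F_linear_mxN].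
pose h (z : prod_variety V F n) : prod_variety V F r :=
  (z.1, of_real_coords (real_coords z.2 *m (invmx (T z.1) *m Phi))).
pose k (z : prod_variety V F r) : prod_variety V F n :=
  (z.1, of_real_coords (real_coords z.2 *m (Psi *m T z.1))).
have gr : good (restr E U).
  by apply: (geo_I geo) => //; exact: (geo_prod geo).
have gp : good (prod_over F r U) by exact: (geo_prod geo).
have Efix x w : A x -> fiber E x w ->
    real_coords w *m bundle_proj E x = real_coords w.
  by move=> /oE[_ _ fixE] /fixE.
have hk z : prod_over F r U z -> h (k z) = z.
  case: z => x c [/= Ux _]; rewrite /h /k /= of_real_coordsK; congr pair.
  rewrite !mulmxA -[_ *m T x *m _]mulmxA mulmxV ?uT // mulmx1 -mulmxA PsiPhi.
  by rewrite mulmx1 real_coordsK.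
have kh z : restr E U z -> k (h z) = z.
  case: z => x w [/= Exw [/= Ux _]]; rewrite /h /k /= of_real_coordsK; congr pair.
  have -> : real_coords w *m (invmx (T x) *m Phi) *m (Psi *m T x) =
      real_coords w *m (invmx (T x) *m P0 *m T x).
    by rewrite /P0 -PhiPsi !mulmxA.
  rewrite mul_invrotation_proj ?PP ?uT //; last exact: UA.
  rewrite -mulmxA mulVmx ?uT // mulmx1 Efix ?real_coordsK //; exact: UA.
have kE z : prod_over F r U z -> restr E U (k z).
  case: z => x c [/= Ux _]; split; last by split.
  suff : fiber E x (k (x, c)).2 by [].
  have [_ _ -> /=] := oE x (UA _ Ux); rewrite of_real_coordsK -!mulmxA.
  rewrite mul_rotation_proj ?PP //; last exact: UA.
  by rewrite -(mul_proj_rotation _ (PP _ Ax0)) [Psi *m (_ *m _)]mulmxA PsiP0.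
have hU z : restr E U z -> prod_over F r U (h z) by move=> [_ []].
exists h; split.
  exists k; split=> //; apply/(geo_mor geo) => //; split=> //.
    have clr := geo_class geo gr.
    have Kz : coords_in (K (restr E U)) (@id (prod_variety V F n)).
      by move=> i j; exact: (geo_coord geo).
    apply: coords_in_prod; first exact: coords_in_fst Kz.
    apply: (mx_class_ext clr (M := fun z =>
      real_coords z.2 *m (invmx (T z.1) *m Phi))).
      by move=> z _; rewrite of_real_coordsK.
    apply: (mx_classM clr); first exact: coords_in_snd Kz.
    apply: (mx_classM clr); last exact: (mx_class_cst clr).
    apply: (mx_classV clr) => [|z [_ [[]]] //].
    by apply: (geo_fst gr _ KT) => z [_ [/UA]].
  have clp := geo_class geo gp.
  have Kz : coords_in (K (prod_over F r U)) (@id (prod_variety V F r)).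
    by move=> i j; exact: (geo_coord geo).
  apply: coords_in_prod; first exact: coords_in_fst Kz.
  apply: (mx_class_ext clp (M := fun z => real_coords z.2 *m (Psi *m T z.1))).
    by move=> z _; rewrite of_real_coordsK.
  apply: (mx_classM clp); first exact: coords_in_snd Kz.
  apply: (mx_classM clp); first exact: (mx_class_cst clp).
  move=> i j; have := geo_comp geo (h := fst : prod_variety V F r -> V) gp
    (coords_in_fst Kz) (KT i j).
  by rewrite setIidl // => z [/UA].
move=> y Uy; split=> //.
  move=> a u v Eu Ev; apply: F_linear_mxP.
  apply: F_linear_mxM => //; apply: F_linear_mxV; first exact: uT.
  exact/FT/UA.
split=> //.
  move=> u v; rewrite !inE => Eu Ev huv.
  have hE w : h (y, w) = (y, (h (y, w)).2) by [].
  have := kh (y, u) (conj Eu (conj Uy I)).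
  by rewrite hE huv -hE kh // => -[].
move=> c _; exists (k (y, c)).2.
  by have [] := kE (y, c) (conj Uy I).
have kcE : k (y, c) = (y, (k (y, c)).2) by [].
by rewrite -kcE hk.
Qed.

End BundlesInGeometry.

Section BundleEquation.
Variables (R : realType) (op : open_kind R) (mor : map_kind R).
Variables (K : sheaf_kind R) (good : forall V : affineVariety R, set V -> Prop).
Hypothesis geo : geometry op mor K good.
Variables (V : affineVariety R) (F : scalar_kind) (n : nat).
Implicit Types (A U : set V) (E : set (prod_variety V F n)).

(** The fiber over [x] consists of the vectors fixed by the projector; a sum of
    squares gathers the equations into one. *)
Lemma bundle_equation A E : good A -> mx_class (K A) (bundle_proj E) ->
  (forall x, A x -> orth_proj (fiber E x) (bundle_proj E x)) ->
  exists2 f, K (prod_over F n A) f &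
    forall z, prod_over F n A z -> (E z <-> f z = 0).
Proof.
move=> gA KE oE; have gP : good (prod_over F n A) by exact: (geo_prod geo).
have clP := geo_class geo gP.
pose d (z : prod_variety V F n) :=
  real_coords z.2 *m bundle_proj E z.1 + - real_coords z.2.
have Kz : coords_in (K (prod_over F n A)) (@id (prod_variety V F n)).
  by move=> i j; exact: (geo_coord geo).
have Kd : mx_class (K (prod_over F n A)) d.
  apply: (mx_classD clP); last by apply: (mx_classN clP); exact: coords_in_snd Kz.
  apply: (mx_classM clP); first exact: coords_in_snd Kz.
  by apply: (geo_fst geo gP _ KE).
(* The squared norm of d z. *)
exists (fun z => (d z *m (d z)^T) 0 0).
  by apply: (mx_classM clP) => //; exact: (mx_classT clP).
move=> [x w] [/= Ax _]; have [_ _ fixE] := oE x Ax.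
have -> : E (x, w) <-> d (x, w) = 0.
  split=> [/fixE dE|/eqP]; first by rewrite /d /= dE subrr.
  by rewrite /d /= subr_eq0 => /eqP/fixE.
split=> [->|d0]; first by rewrite mul0mx mxE.
by apply: dot_eq0; apply/rowP => i; rewrite ord1 d0 mxE.
Qed.

Lemma locally_trivial_proj A E : good A -> good E ->
  (forall x, A x -> vector_subspace (fiber E x)) ->
  locally_trivial op mor A E -> forall x, A x -> exists U,
  [/\ open_in (@op V) A U, U x, mx_class (K U) (bundle_proj E) &
      forall y, U y -> orth_proj (fiber E y) (bundle_proj E y) /\
        exists r f g, @linear_chart R F n r (fiber E y) f g].
Proof.
move=> gA gE sE lt x Ax; have [U [opU Ux [r [h [iso_h lin_h]]]]] := lt x Ax.
have UA : U `<=` A by case: opU => O _ -> y [].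
have gU : good U by exact: (geo_open geo) opU.
have gEU : good (restr E U) by apply: (geo_I geo) => //; exact: (geo_prod geo).
have sEU y : U y -> vector_subspace (fiber E y) by move=> /UA; exact: sE.
have [oE KE] := trivialization_proj geo gU gEU sEU iso_h lin_h.
have [k [_ mor_k kh hk]] := iso_h.
have gP : good (prod_over F r U) by exact: (geo_prod geo).
have [kE _] := (geo_mor geo _ gP gEU).1 mor_k.
exists U; split=> // y Uy; split; first exact: oE.
have [_ ch] := trivialization_chart (sEU y Uy) Uy kE kh hk lin_h.
by exists r; do 2 eexists; exact: ch.
Qed.

End BundleEquation.

(** * Noetherianity of the Zariski topology *)

Section Noetherian.

Definition lincomb (A : comNzRingType) (a : nat -> A) n (x : A) : Prop :=
  exists c : nat -> A, x = \sum_(i < n) c i * a i.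

(** The ascending chain condition for the ideals generated by the initial
    segments of a sequence. *)
Definition noetherian (A : comNzRingType) : Prop :=
  forall a : nat -> A, exists n, lincomb a n (a n).

Lemma lincombB (A : comNzRingType) (a : nat -> A) n x y :
  lincomb a n x -> lincomb a n y -> lincomb a n (x - y).
Proof.
move=> [c ->] [d ->]; exists (fun i => c i - d i).
by rewrite -sumrB; apply: eq_bigr => i _; rewrite mulrBl.
Qed.

Lemma lincombM (A : comNzRingType) (a : nat -> A) n x y :
  lincomb a n x -> lincomb a n (y * x).
Proof.
move=> [c ->]; exists (fun i => y * c i); rewrite mulr_sumr.
by apply: eq_bigr => i _; rewrite mulrA.
Qed.

Lemma lincomb0 (A : comNzRingType) (a : nat -> A) n : lincomb a n 0.
Proof. by exists (fun=> 0); rewrite big1 // => i _; rewrite mul0r. Qed.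

Lemma lincombD (A : comNzRingType) (a : nat -> A) n x y :
  lincomb a n x -> lincomb a n y -> lincomb a n (x + y).
Proof.
move=> ax ay; rewrite -[y]opprK; apply: lincombB => //.
by rewrite -sub0r; apply: lincombB => //; exact: lincomb0.
Qed.

Lemma lincomb_sum (A : comNzRingType) (a : nat -> A) n k (f : 'I_k -> A) :
  (forall i, lincomb a n (f i)) -> lincomb a n (\sum_i f i).
Proof.
move=> af; elim/big_ind: _ => //; [exact: lincomb0|exact: lincombD].
Qed.

Lemma lincomb_gen (A : comNzRingType) (a : nat -> A) n i : (i < n)%N ->
  lincomb a n (a i).
Proof.
move=> lt_in; exists (fun j => (j == i)%:R).
rewrite (bigD1 (Ordinal lt_in)) //= eqxx mul1r big1 ?addr0 // => j.
by rewrite -val_eqE /= => /negbTE->; rewrite mul0r.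
Qed.

Lemma lincomb_trans (A : comNzRingType) (a b : nat -> A) n m x :
  (forall i, (i < n)%N -> lincomb b m (a i)) -> lincomb a n x -> lincomb b m x.
Proof.
by move=> ab [c ->]; apply: lincomb_sum => i; apply: lincombM; exact: ab.
Qed.

Lemma noetherian_field (k : fieldType) : noetherian k.
Proof.
move=> a; have [a0|a0] := eqVneq (a 0%N) 0.
  by exists 0%N; rewrite a0; exact: lincomb0.
by exists 1%N, (fun=> a 1%N / a 0%N); rewrite big_ord1 divfK.
Qed.

Lemma noetherian_surj (A B : comNzRingType) (f : {rmorphism A -> B}) :
  (forall y, exists x, f x = y) -> noetherian A -> noetherian B.
Proof.
move=> surj noA b; have [a ab] := choice (fun n => surj (b n)).
have [n [c ac]] := noA a; exists n, (f \o c).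
rewrite -ab ac rmorph_sum; apply: eq_bigr => i _.
by rewrite rmorphM ab.
Qed.

Lemma minimal_size (A : nzRingType) (P : {poly A} -> Prop) : (exists p, P p) ->
  exists p, P p /\ forall q, P q -> (size p <= size q)%N.
Proof.
move=> [p Pp]; have exn : exists n, `[< exists2 q, P q & size q = n >].
  by exists (size p); apply/asboolP; exists p.
case: (ex_minnP exn) => n /asboolP[q Pq <-] min_n; exists q; split=> // q' Pq'.
by apply: min_n; apply/asboolP; exists q'.
Qed.

(** Given a sequence without the required relation, consider the ideal [I] of
    all combinations of its terms, and a sequence [g] in which each [g n] is of
    least size among the elements of [I] that are not combinations of the
    previous terms.  A relation between the lead coefficients of the [g n]
    lowers the size of some [g N] modulo the previous terms, contradicting its
    choice. *)
Lemma hilbert_basis (A : comNzRingType) : noetherian A -> noetherian {poly A}.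
Proof.
move=> noA f; apply: contrapT => bad.
have {}bad n : ~ lincomb f n (f n) by move=> fn; apply: bad; exists n.
pose I g := exists n, lincomb f n g.
have If i : I (f i) by exists i.+1; exact: lincomb_gen.
have I_B g g' : I g -> I g' -> I (g - g').
  move=> [n fg] [n' fg']; exists (maxn n n'); apply: lincombB.
    apply: lincomb_trans fg => i lt_in; apply: lincomb_gen.
    by apply: leq_trans lt_in _; exact: leq_maxl.
  apply: lincomb_trans fg' => i lt_in; apply: lincomb_gen.
  by apply: leq_trans lt_in _; exact: leq_maxr.
have I_M g g' : I g -> I (g' * g).
  by move=> [n fg]; exists n; exact: lincombM.
pose nths (s : seq {poly A}) := fun i => s`_i.
(* The list s holds the terms chosen so far; when they all lie in I, some
   element of I escapes them, as they involve only finitely many f i. *)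
have pick s : exists g, (forall i, (i < size s)%N -> I s`_i) ->
    (I g /\ ~ lincomb (nths s) (size s) g) /\
    (forall g', I g' /\ ~ lincomb (nths s) (size s) g' -> (size g <= size g')%N).
  have [Is|nIs] := pselect (forall i, (i < size s)%N -> I s`_i); last first.
    by exists 0.
  have [|g [gP gmin]] := @minimal_size _
      (fun g => I g /\ ~ lincomb (nths s) (size s) g); last by exists g.
  apply: contrapT => all_s.
  have {}all_s g : I g -> lincomb (nths s) (size s) g.
    by move=> Ig; apply: contrapT => ng; apply: all_s; exists g.
  have [N sN] : exists N, forall i, (i < size s)%N -> lincomb f N s`_i.
    elim: (size s) Is => [_|k IH Is]; first by exists 0%N.
    have [i ik|N fN] := IH; first by apply: Is; exact: ltnW.
    have [N' fN'] := Is k (ltnSn k); exists (maxn N N') => i.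
    rewrite ltnS leq_eqVlt => /orP[/eqP->|/fN fi].
      apply: lincomb_trans fN' => j lt_j; apply: lincomb_gen.
      by apply: leq_trans lt_j _; exact: leq_maxr.
    apply: lincomb_trans fi => j lt_j; apply: lincomb_gen.
    by apply: leq_trans lt_j _; exact: leq_maxl.
  by apply: (bad N); apply: lincomb_trans (all_s _ (If N)).
have [G GP] := choice pick.
pose build := fix build n := if n is n'.+1 then rcons (build n') (G (build n'))
  else [::].
pose g n := G (build n).
have sb n : size (build n) = n by elim: n => //= n IH; rewrite size_rcons IH.
have nthb n i : (i < n)%N -> (build n)`_i = g i.
  elim: n => // n IH; rewrite ltnS leq_eqVlt /= nth_rcons sb.
  by move=> /orP[/eqP->|lt_in]; rewrite ?ltnn ?eqxx // lt_in IH.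
have lcb n x : lincomb (nths (build n)) (size (build n)) x <-> lincomb g n x.
  rewrite sb; split; apply: lincomb_trans => i lt_in.
    by rewrite /nths nthb //; exact: lincomb_gen.
  by rewrite -(nthb n) //; exact: (lincomb_gen (nths (build n))).
have gP n : (I (g n) /\ ~ lincomb g n (g n)) /\
    forall g', I g' /\ ~ lincomb g n g' -> (size (g n) <= size g')%N.
  elim/ltn_ind: n => n IH.
  have [|[Ig ng] gmin] := GP (build n).
    by move=> i; rewrite sb => lt_in; rewrite nthb //; have [[]] := IH i lt_in.
  split; first by split=> // /lcb.
  by move=> g' [Ig' ng']; apply: gmin; split=> // /lcb.
have [N [c cE]] := noA (fun n => lead_coef (g n)).
have szg i : (i < N)%N -> (size (g i) <= size (g N))%N.
  move=> lt_iN; have [[_ _] gmin] := gP i; have [[IgN ngN] _] := gP N.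
  apply: gmin; split=> // giN; apply: ngN; apply: lincomb_trans giN => j lt_j.
  by apply: lincomb_gen; exact: ltn_trans lt_j lt_iN.
(* The combination of the previous terms with the same lead term as g N. *)
pose h := \sum_(i < N) ((c i)%:P * 'X^(size (g N) - size (g i))) * g i.
have [[IgN ngN] gmin] := gP N.
have lh : lincomb g N h.
  by apply: lincomb_sum => i; apply: lincombM; exact: lincomb_gen.
have Ih : I h.
  have [d ->] := lh; elim/big_ind: _ => [|x y Ix Iy|i _].
  - by exists 0%N; exact: lincomb0.
  - have I0 : I 0 by exists 0%N; exact: lincomb0.
    by have := I_B x (0 - y) Ix (I_B 0 y I0 Iy); rewrite sub0r opprK.
  - by apply: I_M; have [[]] := gP i.
have gN0 : g N != 0 by apply/eqP => gN; apply: ngN; rewrite gN; exact: lincomb0.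
have sgN : (0 < size (g N))%N by rewrite size_poly_gt0.
have gi0 i : (i < N)%N -> (0 < size (g i))%N.
  move=> _; rewrite size_poly_gt0; apply/eqP => gi; have [[_ ni] _] := gP i.
  by apply: ni; rewrite gi; exact: lincomb0.
have top : (g N - h)`_(size (g N)).-1 = 0.
  rewrite coefB -[X in X - _]/(lead_coef (g N)) cE /h coef_sum -sumrB big1 // => i _.
  rewrite -mulrA coefCM coefXnM ifF; last first.
    apply/negbTE; rewrite -leqNgt leq_subLR.
    move: (gi0 i (ltn_ord i)) sgN; case: (size (g i)); case: (size (g N)) => //.
    by move=> a b _ _; rewrite addSn ltnS leq_addl.
  suff -> : ((size (g N)).-1 - (size (g N) - size (g i)) = (size (g i)).-1)%N.
    by rewrite -lead_coefE subrr.
  move: (szg i (ltn_ord i)) (gi0 i (ltn_ord i)) sgN.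
  case: (size (g i)) => // a; case: (size (g N)) => // b ab _ _.
  by rewrite subSS /= subKn.
have szB : (size (g N - h)%R <= size (g N))%N.
  apply: leq_trans (size_polyD _ _) _; rewrite size_polyN geq_max leqnn /=.
  apply: (leq_trans (size_sum _ _ _)); apply/bigmax_leqP => i _.
  rewrite -mulrA mul_polyC; apply: leq_trans (size_scale_leq _ _) _.
  rewrite mulrC size_mulXn -?size_poly_gt0 ?gi0 //.
  by rewrite subnK // szg.
have /gmin szN : I (g N - h) /\ ~ lincomb g N (g N - h).
  split; first exact: I_B.
  by move=> gNh; apply: ngN; rewrite -(subrK h (g N)); exact: lincombD.
have szE : size (g N - h) = size (g N) by apply/eqP; rewrite eqn_leq szB szN.
move: top; rewrite -szE -lead_coefE => /eqP; rewrite lead_coef_eq0 => /eqP gh.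
by move: sgN; rewrite -szE gh size_poly0.
Qed.

Lemma mpoly_ind_ring (R : comNzRingType) m (P : mpoly.mpoly m R -> Prop) :
  (forall c, P (mpoly.mpolyC m c)) ->
  (forall i, P (mpoly.mpolyX R (mpoly.mnm1 i))) ->
  (forall p q, P p -> P q -> P (p + q)) ->
  (forall p q, P p -> P q -> P (p * q)) -> forall p, P p.
Proof.
move=> PC PX PD PM p; rewrite (mpoly.mpolyE p).
have P0 : P 0 by rewrite -(mpoly.mpolyC0 m R).
have P1 : P 1 by exact: PC 1.
apply: (big_ind P P0 PD) => k _; rewrite -mpoly.mul_mpolyC; apply: (PM) => //.
rewrite mpoly.mpolyXE_id; apply: (big_ind P P1 PM) => i _.
by elim: (mpoly.fun_of_multinom k i) => [//|j IH]; rewrite exprS; exact: PM.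
Qed.

(** Substitutes the last variable of [m.+1] for the indeterminate. *)
Definition mpoly_of_poly (R : comNzRingType) m :
    {poly mpoly.mpoly m R} -> mpoly.mpoly m.+1 R :=
  horner_eval (mpoly.mpolyX R (mpoly.mnm1 ord_max)) \o @mpoly.mpwiden m R.

HB.instance Definition _ (R : comNzRingType) m :=
  GRing.RMorphism.on (@mpoly_of_poly R m).

Lemma mpoly_of_polyX (R : comNzRingType) m :
  @mpoly_of_poly R m 'X = mpoly.mpolyX R (mpoly.mnm1 ord_max).
Proof. by rewrite /mpoly_of_poly /= mpoly.mpwidenX /horner_eval hornerX. Qed.

Lemma mpoly_of_polyC (R : comNzRingType) m (c : mpoly.mpoly m R) :
  mpoly_of_poly c%:P = mpoly.mwiden c.
Proof. by rewrite /mpoly_of_poly /= mpoly.mpwidenC /horner_eval hornerC. Qed.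

Lemma mpoly_of_poly_surj (R : comNzRingType) m (p : mpoly.mpoly m.+1 R) :
  exists q, mpoly_of_poly q = p.
Proof.
elim/mpoly_ind_ring: p => [c|i|p q [p' <-] [q' <-]|p q [p' <-] [q' <-]].
- exists (mpoly.mpolyC m c)%:P.
  by rewrite mpoly_of_polyC mpoly.mwidenC.
- have [->|imax] := eqVneq i ord_max.
    by exists 'X; rewrite mpoly_of_polyX.
  have lt_im : (i < m)%N.
    have := ltn_ord i; rewrite ltnS leq_eqVlt => /orP[/eqP im|//].
    by case/eqP: imax; exact: val_inj.
  exists (mpoly.mpolyX R (mpoly.mnm1 (Ordinal lt_im)))%:P.
  rewrite mpoly_of_polyC mpoly.mwidenX.
  rewrite mpoly.mnmwiden1; congr (mpoly.mpolyX _ (mpoly.mnm1 _)); exact: val_inj.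
- by exists (p' + q'); rewrite rmorphD.
- by exists (p' * q'); rewrite rmorphM.
Qed.

Lemma noetherian_mpoly (k : fieldType) m : noetherian (mpoly.mpoly m k).
Proof.
elim: m => [|m IH].
  apply: (@noetherian_surj k _ (@mpoly.mpolyC 0 k) _ (@noetherian_field k)) => p.
  elim/mpoly_ind_ring: p => [c|[]//|p q [p' <-] [q' <-]|p q [p' <-] [q' <-]].
  - by exists c.
  - by exists (p' + q'); rewrite rmorphD.
  - by exists (p' * q'); rewrite rmorphM.
apply: (@noetherian_surj _ _ (@mpoly_of_poly k m) _ (hilbert_basis IH)).
exact: mpoly_of_poly_surj.
Qed.

End Noetherian.

Section ZariskiNoetherian.
Variables (R : realType) (V : affineVariety R).

(** Polynomials that separate the successive terms of a strictly decreasing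
    sequence of closed sets would form a sequence without relations. *)
Lemma zariski_minimal (P : set V -> Prop) :
  (forall C, P C -> zariski_closed C) -> (exists C, P C) ->
  exists C, P C /\ forall D, P D -> D `<=` C -> D = C.
Proof.
move=> clP [C0 PC0]; apply: contrapT => no_min.
have step C : exists D, P C -> [/\ P D, D `<=` C & D <> C].
  have [PC|] := pselect (P C); last by exists C.
  apply: contrapT => nD; apply: no_min; exists C; split=> // D PD DC.
  by apply: contrapT => DneC; apply: nD; exists D.
have [next nextP] := choice step.
pose C n := iter n next C0.
have PC n : P (C n) by elim: n => //= n /nextP[].
have sep n : exists p, vanish (C n.+1) p /\ ~ vanish (C n) p.
  have [PD DC DneC] := nextP _ (PC n).
  apply: contrapT => np; apply: DneC; apply/seteqP; split=> // x Cx.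
  apply: ((zariski_closedP _).1 (clP _ PD)) => q Dq; apply: contrapT => qx.
  by apply: np; exists q; split=> // Cq; apply: qx; exact: Cq.
have [p pP] := choice sep.
have decr i n : (i <= n)%N -> C n `<=` C i.
  move=> /subnK<-; elim: (n - i)%N => // k IH x /= Cx; apply: IH.
  by have [_ DC _] := nextP _ (PC (k + i)%N); exact: DC.
have [n [c pn]] := noetherian_mpoly p.
apply: (pP n).2 => x Cx; rewrite pn.
have : forall i : 'I_n, peval (p i) (av_emb x) = 0.
  by move=> i; apply: (pP i).1; apply: decr Cx.
elim/big_ind: _ => [_|q q' q0 q'0 pi0|i _ pi0]; first exact: peval0.
  by rewrite pevalD q0 ?q'0 ?addr0.
by rewrite pevalM pi0 mulr0.
Qed.

End ZariskiNoetherian.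

(** * Central points of irreducible real algebraic sets *)

Section RealPolynomials.
Variable R : realType.
Implicit Type p : {poly R}.

Lemma poly_eq0_near p (t0 e : R) : 0 < e ->
  (forall t, `|t - t0| < e -> p.[t] = 0) -> p = 0.
Proof.
move=> e0 p0; apply/eqP; apply: contraT => pn0.
(* More roots than the size of p allows. *)
pose t (i : nat) : R := t0 + e / i.+2%:R.
pose rs := [seq t i | i <- iota 0 (size p)].
have := max_poly_roots (rs := rs) pn0.
rewrite size_map size_iota ltnn; apply.
  apply/allP => _ /mapP[i _ ->]; rewrite rootE p0 // /t addrAC subrr add0r.
  rewrite ger0_norm ?divr_ge0 ?ltW // ltr_pdivrMr // -[X in X < _]mulr1.
  by rewrite ltr_pM2l // ltr1n.
rewrite map_inj_uniq ?iota_uniq // => i j /addrI/(mulfI (lt0r_neq0 e0)).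
by move=> /invr_inj/eqP; rewrite eqr_nat => /eqP[].
Qed.

Lemma poly_ivt_sign p (t1 t2 : R) : t1 < t2 -> p.[t1] * p.[t2] < 0 ->
  exists t, [/\ t1 <= t, t <= t2 & p.[t] = 0].
Proof.
wlog p1 : p / p.[t1] <= 0 => [ivt t12 p12|t12 p12].
  have [|/ltW p1] := leP p.[t1] 0; first by move=> /ivt; apply.
  have [||| t [? ? pt]] := ivt (- p); rewrite ?hornerN ?oppr_le0 ?mulrNN //.
  by exists t; split=> //; apply/eqP; rewrite -oppr_eq0 -hornerN pt.
have p2 : 0 <= p.[t2].
  rewrite leNgt; apply/negP => /ltW p2.
  by have := mulr_le0 p1 p2; rewrite leNgt p12.
have [|t /andP[t1t tt2] /rootP pt] := @poly_ivt _ p _ _ (ltW t12).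
  by rewrite p1 p2.
by exists t.
Qed.

Lemma simple_root_sign_change p (t0 e : R) : 0 < e -> p.[t0] = 0 ->
  p^`().[t0] != 0 ->
  exists t1 t2, [/\ t0 - e < t1, t1 < t2, t2 < t0 + e & p.[t1] * p.[t2] < 0].
Proof.
move=> e0 /rootP/factor_theorem[q ->].
rewrite derivM derivXsubC mulr1 hornerD hornerM hornerXsubC subrr mulr0 add0r.
move=> q0; have : \forall t \near t0, 0 < q.[t] * q.[t0].
  have cq : (fun t => q.[t] * q.[t0]) @ t0 --> q.[t0] * q.[t0].
    by apply: cvgM; [exact: continuous_horner|exact: cvg_cst].
  by apply: (cvgr_gt _ cq); rewrite -expr2 exprn_even_gt0.
move=> /nbhs_ballP[d /= d0 qd].
pose s := Num.min d e / 2.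
have s0 : 0 < s by rewrite divr_gt0 // lt_min d0 e0.
have sd : s < d.
  rewrite ltr_pdivrMr // mulr_natr mulr2n (le_lt_trans (y := d)) ?ltrDl //.
  by rewrite ge_min lexx.
have se : s < e.
  rewrite ltr_pdivrMr // mulr_natr mulr2n (le_lt_trans (y := e)) ?ltrDl //.
  by rewrite ge_min lexx orbT.
have q1 : 0 < q.[t0 - s] * q.[t0].
  by apply: qd; rewrite /ball /= opprB addrC subrK gtr0_norm.
have q2 : 0 < q.[t0 + s] * q.[t0].
  by apply: qd; rewrite /ball /= opprD addrA subrr sub0r normrN gtr0_norm.
exists (t0 - s), (t0 + s); split; try lra.
have q12 : 0 < q.[t0 - s] * q.[t0 + s].
  have qq : 0 < q.[t0] * q.[t0] by rewrite -expr2 exprn_even_gt0.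
  by rewrite -(pmulr_lgt0 _ qq) mulrACA mulr_gt0 // mulrC.
rewrite !hornerM !hornerXsubC.
have -> : q.[t0 - s] * (t0 - s - t0) * (q.[t0 + s] * (t0 + s - t0)) =
  - (s * s * (q.[t0 - s] * q.[t0 + s])) by ring.
by rewrite oppr_lt0 mulr_gt0 // mulr_gt0.
Qed.

End RealPolynomials.

Section LastVariable.
Variables (R : realType) (m : nat).
Local Notation poly2 := {poly mpoly.mpoly m R}.
Implicit Types (y : 'rV[R]_m) (v : 'rV[R]_m.+1) (p q : poly2).

Definition init_row v : 'rV[R]_m := \row_j v 0 (lift ord_max j).

(** The point with last coordinate [t] and other coordinates [y]. *)
Definition join_row y (t : R) : 'rV[R]_m.+1 :=
  \row_i (if unlift ord_max i is Some j then y 0 j else t).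

Lemma join_rowK y t : init_row (join_row y t) = y.
Proof. by apply/rowP => j; rewrite !mxE liftK. Qed.

Lemma join_row_max y t : join_row y t 0 ord_max = t.
Proof. by rewrite mxE unlift_none. Qed.

(** The restriction of [q] to the line over [y]. *)
Definition fiber_poly y : poly2 -> {poly R} :=
  map_poly (mpoly.meval (fun i => y 0 i)).

HB.instance Definition _ y := GRing.RMorphism.on (fiber_poly y).

Lemma fiber_polyB y p q : fiber_poly y (p - q) = fiber_poly y p - fiber_poly y q.
Proof. exact: rmorphB. Qed.
Lemma fiber_polyM y p q : fiber_poly y (p * q) = fiber_poly y p * fiber_poly y q.
Proof. exact: rmorphM. Qed.
Lemma fiber_polyZ y c q : fiber_poly y (c *: q) = peval c y *: fiber_poly y q.
Proof. exact: map_polyZ. Qed.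
Lemma fiber_polyC y c : fiber_poly y c%:P = (peval c y)%:P.
Proof. exact: map_polyC. Qed.

Lemma peval_mwiden (c : mpoly.mpoly m R) v :
  peval (mpoly.mwiden c) v = peval c (init_row v).
Proof.
elim/mpoly_ind_ring: c => [c|i|c d Hp Hq|c d Hp Hq].
- by rewrite mpoly.mwidenC !pevalC.
- rewrite mpoly.mwidenX mpoly.mnmwiden1 !pevalX mxE.
  by congr (v 0 _); apply: val_inj; exact: (esym (lift_max i)).
- by rewrite mpoly.mwidenD !pevalD Hp Hq.
- by rewrite mpoly.mwidenM !pevalM Hp Hq.
Qed.

Lemma peval_mpoly_of_poly q v : peval (mpoly_of_poly q) v =
  (fiber_poly (init_row v) q).[v 0 ord_max].
Proof.
elim/poly_ind: q => [|q c IH]; first by rewrite !rmorph0 peval0 horner0.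
have -> : mpoly_of_poly (q * 'X + c%:P) = mpoly_of_poly q *
    mpoly.mpolyX R (mpoly.mnm1 ord_max) + mpoly.mwiden c.
  rewrite rmorphD rmorphM; congr (_ * _ + _).
    exact: mpoly_of_polyX.
  exact: mpoly_of_polyC.
have -> : fiber_poly (init_row v) (q * 'X + c%:P) =
    fiber_poly (init_row v) q * 'X + (peval c (init_row v))%:P.
  by rewrite /fiber_poly rmorphD rmorphM /= map_polyX map_polyC.
by rewrite pevalD pevalM IH pevalX peval_mwiden hornerD hornerMX hornerC.
Qed.

Lemma horner_fiber_poly y q t :
  (fiber_poly y q).[t] = peval q.[mpoly.mpolyC m t] y.
Proof.
have {1}-> : t = mpoly.meval (fun i => y 0 i) (mpoly.mpolyC m t).
  by rewrite mpoly.mevalC.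
by rewrite horner_map.
Qed.

Lemma nbhs_join_row v (N : set 'rV[R]_m.+1) : nbhs v N ->
  exists N1 e, [/\ nbhs (init_row v) N1, 0 < e &
    forall y t, N1 y -> `|t - v 0 ord_max| < e -> N (join_row y t)].
Proof.
move=> [P nP PN]; have /nbhs_ballP[e /= e0 eP] := nP 0 ord_max.
exists [set y | forall i j, P i (lift ord_max j) (y i j)], e; split=> //.
  exists (fun i j => P i (lift ord_max j)) => // i j.
  by rewrite !mxE ord1; exact: nP.
move=> y t Py te; apply: PN => i j; rewrite ord1 mxE.
case: unliftP => [k ->|->]; first exact: Py.
by apply: eP; rewrite /ball /= distrC.
Qed.

End LastVariable.

Lemma continuous_peval (R : realType) m (p : mpoly.mpoly m R) :
  continuous (peval p : 'rV[R]_m -> R).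
Proof.
have fc := function_class_continuous R (setT : set 'rV[R]_m).
rewrite continuous_subspace_setT; apply: (fc_peval fc (h := id)) => i.
by apply: continuous_subspaceT; exact: (@coord_continuous R 1 m 0 i).
Qed.

Section Varieties.
Variables (R : realType) (m : nat).
Implicit Types (Z : set 'rV[R]_m) (p q : mpoly.mpoly m R).

Definition vanish_on Z p : Prop := forall v, Z v -> peval p v = 0.

(** The second clause says that [Z] is not empty, and the third that the ideal
    of [Z] is prime. *)
Definition closed_irreducible Z : Prop :=
  [/\ forall v, (forall p, vanish_on Z p -> peval p v = 0) -> Z v,
      ~ vanish_on Z 1 &
      forall p q, vanish_on Z (p * q) -> vanish_on Z p \/ vanish_on Z q].

Lemma vanish_on_exp Z p k : closed_irreducible Z ->
  vanish_on Z (p ^+ k) -> vanish_on Z p.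
Proof.
move=> [_ Z1 prZ]; elim: k => [/Z1//|k IH]; rewrite exprS.
by move=> /prZ[|/IH].
Qed.

End Varieties.

Section Projection.
Variables (R : realType) (m : nat) (Z : set 'rV[R]_m.+1).
Hypothesis irrZ : closed_irreducible Z.
Local Notation poly2 := {poly mpoly.mpoly m R}.
Implicit Types (y : 'rV[R]_m) (v : 'rV[R]_m.+1) (q d f : poly2).

(** The Zariski closure of the projection of [Z]: its equations are the
    polynomials in the first [m] variables that vanish on [Z]. *)
Definition closed_image : set 'rV[R]_m :=
  [set y | forall c, vanish_on Z (mpoly.mwiden c) -> peval c y = 0].
Local Notation Y := closed_image.

Lemma closed_image_init v : Z v -> Y (init_row v).
Proof. by move=> Zv c Zc; rewrite -peval_mwiden; exact: Zc. Qed.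

Lemma vanish_closed_image c : vanish_on Y c <-> vanish_on Z (mpoly.mwiden c).
Proof.
split=> [Yc v Zv|Zc y]; last exact.
by rewrite peval_mwiden; apply: Yc; exact: closed_image_init.
Qed.

Lemma closed_image_irreducible : closed_irreducible Y.
Proof.
have [_ Z1 prZ] := irrZ; split.
- by move=> y yY c /vanish_closed_image; exact: yY.
- by move=> /vanish_closed_image; rewrite mpoly.mwiden1.
- move=> p q /vanish_closed_image; rewrite mpoly.mwidenM.
  by move=> /prZ[] /vanish_closed_image; [left|right].
Qed.

Definition vanish2 q : Prop :=
  forall v, Z v -> (fiber_poly (init_row v) q).[v 0 ord_max] = 0.

Lemma vanish2P q : vanish2 q <-> vanish_on Z (mpoly_of_poly q).
Proof.
by split=> Zq v /Zq; rewrite peval_mpoly_of_poly.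
Qed.

Lemma vanish2M q q' : vanish2 (q * q') -> vanish2 q \/ vanish2 q'.
Proof.
have [_ _ prZ] := irrZ.
by move=> /vanish2P; rewrite rmorphM => /prZ[] /vanish2P; [left|right].
Qed.

(** Equivalently, [d] vanishes on the whole cylinder over the closed image. *)
Definition coefs_vanish d : Prop := forall i, vanish_on Y d`_i.

Lemma coefs_vanish_fiber d y : coefs_vanish d -> Y y -> fiber_poly y d = 0.
Proof.
move=> nd Yy; apply/polyP => i; rewrite coef_map coef0; exact: nd.
Qed.

(** Leading terms whose coefficient vanishes on the closed image are removed
    one by one; a shortest outcome is chosen at once. *)
Lemma strip (P : poly2 -> Prop) q :
  (forall q' d, P q' -> coefs_vanish d -> P (q' - d)) ->
  P q -> ~ coefs_vanish q ->
  exists q', [/\ P q', ~ vanish_on Y (lead_coef q') & (size q' <= size q)%N].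
Proof.
move=> PB Pq nq.
have [|q' [[Pq' nq'] min_q']] := @minimal_size _
    (fun q' => P q' /\ coefs_vanish (q - q')).
  exists q; split=> // i y Yy; rewrite subrr coef0; exact: peval0.
exists q'; split=> //; last first.
  by apply: min_q'; split=> // i y Yy; rewrite subrr coef0; exact: peval0.
move=> lq'; pose d := lead_coef q' *: 'X^((size q').-1).
have nd : coefs_vanish d.
  move=> i y Yy; rewrite coefZ coefXn.
  by case: eqP => _; rewrite ?mulr1 ?mulr0 ?peval0 //; exact: lq'.
have q'0 : q' != 0.
  apply/eqP => q'0; apply: nq; move: nq'; rewrite q'0 subr0; exact.
have : (size q' <= size (q' - d)%R)%N.
  apply: min_q'; split; first exact: PB.
  move=> i y Yy; have -> : q - (q' - d) = (q - q') + d by rewrite opprB addrA addrAC.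
  by rewrite coefD pevalD nq' // nd // addr0.
apply/negP; rewrite -ltnNge -[X in (_ < X)%N]prednK ?size_poly_gt0 // ltnS.
apply/leq_sizeP => j le_j; rewrite coefB coefZ coefXn.
have [->|ne_j] := eqVneq j (size q').-1; first by rewrite mulr1 -lead_coefE subrr.
rewrite mulr0 subr0; have /leq_sizeP := leqnn (size q'); apply.
by rewrite -[X in (X <= _)%N]prednK ?size_poly_gt0 // ltn_neqAle eq_sym ne_j.
Qed.

Lemma min_coefs_vanish f q :
  (forall q', vanish2 q' -> ~ vanish_on Y (lead_coef q') ->
     (size f <= size q')%N) ->
  vanish2 q -> (size q < size f)%N -> coefs_vanish q.
Proof.
move=> min_f Zq lt_qf; apply: contrapT => nq.
have [|q' [Zq' lq' le_q']] := strip _ Zq nq.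
  move=> q1 d Zq1 nd v Zv; rewrite fiber_polyB hornerD hornerN Zq1 //.
  rewrite coefs_vanish_fiber //.
    by rewrite horner0 oppr0 addr0.
  exact: closed_image_init.
by have := leq_trans lt_qf (min_f _ Zq' lq'); rewrite ltnNge le_q'.
Qed.

(** Let [f] be of least size among the polynomials vanishing on [Z] whose lead
    coefficient does not vanish on the closed image.  Then [U], a piece of the
    zero set of [f] whose projection is dense enough, already decides which
    polynomials vanish on [Z].  Let [h] vanish on [U], have a lead coefficient
    not vanishing on the closed image, and be of least size for this; it is
    not constant, by density.  If [h] were shorter than [f], the pseudo-division of [f] by [h] would have a
    remainder vanishing on the cylinder, so that the product of [h] and the
    quotient, both shorter than [f], would vanish on the irreducible set [Z],
    against the choice of [f].  Hence remainders modulo [f] that vanish on [U]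
    vanish on the cylinder, and a polynomial vanishing on [U] vanishes on [Z],
    where [f] does. *)
Lemma vanish_sheet f (U : 'rV[R]_m -> R -> Prop) :
  vanish2 f -> ~ vanish_on Y (lead_coef f) ->
  (forall q', vanish2 q' -> ~ vanish_on Y (lead_coef q') ->
     (size f <= size q')%N) ->
  (forall y t, U y t -> Y y /\ (fiber_poly y f).[t] = 0) ->
  (forall c, (forall y t, U y t -> peval c y = 0) -> vanish_on Y c) ->
  forall q, (forall y t, U y t -> (fiber_poly y q).[t] = 0) -> vanish2 q.
Proof.
move=> Zf lf min_f UY Udense.
have irrY := closed_image_irreducible; have [_ _ prY] := irrY.
pose P q := forall y t, U y t -> (fiber_poly y q).[t] = 0.
have PB q d : P q -> coefs_vanish d -> P (q - d).
  move=> Pq nd y t Uyt; have [Yy _] := UY y t Uyt.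
  by rewrite fiber_polyB hornerD hornerN Pq // coefs_vanish_fiber // horner0 oppr0 addr0.
have f0 : f != 0.
  by apply/eqP => f0; apply: lf => y _; rewrite f0 lead_coef0 peval0.
have divE (q h : poly2) y : fiber_poly y (q %% h) =
    (peval (lead_coef h ^+ scalp q h) y) *: fiber_poly y q -
    fiber_poly y (q %/ h) * fiber_poly y h.
  rewrite -fiber_polyM -fiber_polyZ -fiber_polyB; congr fiber_poly.
  by rewrite Pdiv.Idomain.divp_eq addrAC subrr add0r.
(* The size of f is also least among the polynomials vanishing on U. *)
have min_h h : P h -> ~ vanish_on Y (lead_coef h) -> ~ (size h < size f)%N.
  move=> Ph lh lt_hf.
  have [|h' [[Ph' lh'] min_h']] := @minimal_size _
    (fun h => P h /\ ~ vanish_on Y (lead_coef h)); first by exists h.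
  have lt_h'f := leq_ltn_trans (min_h' _ (conj Ph lh)) lt_hf.
  move: h' Ph' lh' min_h' lt_h'f => {h Ph lh lt_hf} h Ph lh min_h lt_hf.
  have h0 : h != 0.
    by apply/eqP => h0; apply: lh => y _; rewrite h0 lead_coef0 peval0.
  have sh : (1 < size h)%N.
    rewrite ltnNge; apply/negP => /size1_polyC hc; apply: lh.
    rewrite hc lead_coefC; apply: Udense => y t /Ph.
    by rewrite {1}hc fiber_polyC hornerC.
  have Pr : P (f %% h).
    move=> y t Uyt; have [_ fyt] := UY y t Uyt.
    by rewrite divE hornerD hornerN hornerZ hornerM fyt Ph // !mulr0 subr0.
  have nr : coefs_vanish (f %% h).
    apply: contrapT => nr; have [q' [Pq' lq' le_q']] := strip PB Pr nr.
    have := min_h _ (conj Pq' lq'); rewrite leqNgt; apply/negP/negPn.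
    by apply: leq_ltn_trans le_q' _; rewrite ltn_modp.
  have : vanish2 (f %/ h * h).
    move=> v Zv; have := divE f h (init_row v).
    rewrite (coefs_vanish_fiber nr (closed_image_init Zv)) => /eqP.
    rewrite eq_sym subr_eq0 -fiber_polyM => /eqP <-.
    by rewrite hornerZ Zf // mulr0.
  move=> /vanish2M[Zs|Zh]; last by have := min_f _ Zh lh; rewrite leqNgt lt_hf.
  have ns : coefs_vanish (f %/ h).
    apply: (min_coefs_vanish min_f Zs); rewrite Pdiv.Idomain.size_divp //.
    rewrite ltn_subrL size_poly_gt0 f0 andbT.
    by case: (size h) sh => [|[|]].
  have : vanish_on Y (lead_coef h ^+ scalp f h * lead_coef f).
    move=> y Yy; have := divE f h y.
    rewrite (coefs_vanish_fiber nr Yy) (coefs_vanish_fiber ns Yy) mul0r subr0.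
    move=> /polyP/(_ (size f).-1); rewrite coef0 coefZ coef_map pevalM.
    by move=> /esym.
  by move=> /prY[/(vanish_on_exp irrY)|].
move=> q Pq.
have Pr : P (q %% f).
  move=> y t Uyt; have [_ fyt] := UY y t Uyt.
  by rewrite divE hornerD hornerN hornerZ hornerM fyt Pq // !mulr0 subr0.
have nr : coefs_vanish (q %% f).
  apply: contrapT => nr; have [q' [Pq' lq' le_q']] := strip PB Pr nr.
  by apply: (min_h q') => //; apply: leq_ltn_trans le_q' _; rewrite ltn_modp.
have : vanish2 ((lead_coef f ^+ scalp q f)%:P * q).
  move=> v Zv; have := divE q f (init_row v).
  rewrite (coefs_vanish_fiber nr (closed_image_init Zv)) => /eqP.
  rewrite eq_sym subr_eq0 => /eqP.
  rewrite mul_polyC fiber_polyZ => ->.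
  by rewrite hornerM Zf // mulr0.
move=> /vanish2M[Zl|//]; case: lf; apply: (vanish_on_exp (k := scalp q f) irrY).
apply/vanish_closed_image => v Zv; have := Zl v Zv.
by rewrite fiber_polyC hornerC peval_mwiden.
Qed.

End Projection.

Section CentralPoints.
Variable R : realType.

(** Points of [Z] where [delta] does not vanish are central: each of their
    Euclidean neighborhoods in [Z] is Zariski dense in [Z]. *)
Definition central_off m (Z : set 'rV[R]_m) (delta : mpoly.mpoly m R) : Prop :=
  forall a N g, Z a -> peval delta a != 0 -> nbhs a N ->
    vanish_on (Z `&` N) g -> vanish_on Z g.

Lemma join_row_closed m (Z : set 'rV[R]_m.+1) y t : closed_irreducible Z ->
  (forall q, vanish2 Z q -> (fiber_poly y q).[t] = 0) -> Z (join_row y t).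
Proof.
move=> [clZ _ _] yt; apply: clZ => p; have [q <-] := mpoly_of_poly_surj p.
by move=> /vanish2P/yt; rewrite peval_mpoly_of_poly join_rowK join_row_max.
Qed.

(** A polynomial that vanishes on a neighborhood in the cylinder restricts to
    zero on a segment of each nearby vertical line, hence on the line, and its
    coefficients vanish on a neighborhood in the base. *)
Lemma central_cylinder m (Z : set 'rV[R]_m.+1) delta : closed_irreducible Z ->
  (forall q, vanish2 Z q -> coefs_vanish Z q) ->
  central_off (closed_image Z) delta -> central_off Z (mpoly.mwiden delta).
Proof.
move=> irrZ allneg cen a N g Za; rewrite peval_mwiden => da.
move=> /nbhs_join_row[N1 [e [nN1 e0 N1e]]].
have [q <-] := mpoly_of_poly_surj g => Ng; apply/vanish2P.
have YZ := closed_image_init Za.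
suff nq : coefs_vanish Z q.
  move=> v Zv; rewrite (coefs_vanish_fiber nq (closed_image_init Zv)).
  exact: horner0.
move=> i; apply: cen YZ da nN1 _ => y [Yy N1y].
have Zyt t : Z (join_row y t).
  apply: join_row_closed => // q' /allneg nq'.
  by rewrite (coefs_vanish_fiber nq' Yy) horner0.
suff /polyP/(_ i) : fiber_poly y q = 0 by rewrite coef_map coef0.
apply: (poly_eq0_near e0 (t0 := a 0 ord_max)) => t te.
have := Ng _ (conj (Zyt t) (N1e y t N1y te)).
by rewrite peval_mpoly_of_poly join_rowK join_row_max.
Qed.

Lemma near_peval_lt0 m (p : mpoly.mpoly m R) y0 : peval p y0 < 0 ->
  nbhs y0 [set y | peval p y < 0].
Proof. by move=> py0; apply: (cvgr_lt _ (continuous_peval (p := p) (x := y0))). Qed.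

Lemma near_peval_neq0 m (p : mpoly.mpoly m R) y0 : peval p y0 != 0 ->
  nbhs y0 [set y | peval p y != 0].
Proof. by move=> py0; apply: (cvgr_neq0 _ (continuous_peval (p := p) (x := y0))). Qed.

(** At a simple root [t0] of [f] over [y0] the polynomial changes sign, so that
    over each nearby [y] it has a root close to [t0].  When moreover the lead
    coefficient does not vanish at [y], this root gives a point of [Z], since
    each polynomial vanishing on [Z] has, up to a power of the lead
    coefficient, a remainder modulo [f] that vanishes over [y]. *)
Lemma central_sheet m (Z : set 'rV[R]_m.+1) delta f : closed_irreducible Z ->
  vanish2 Z f -> ~ vanish_on (closed_image Z) (lead_coef f) ->
  (forall q, vanish2 Z q -> ~ vanish_on (closed_image Z) (lead_coef q) ->
     (size f <= size q)%N) ->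
  central_off (closed_image Z) delta ->
  central_off Z (mpoly_of_poly (delta%:P * (lead_coef f)%:P * f^`())).
Proof.
move=> irrZ Zf lf min_f cen a N g Za; rewrite peval_mpoly_of_poly.
set y0 := init_row a; set t0 := a 0 ord_max.
rewrite !fiber_polyM !fiber_polyC !hornerM !hornerC !mulf_eq0 !negb_or.
move=> /andP[/andP[dy0 ly0] f'0] /nbhs_join_row[N1 [e [nN1 e0 N1e]]].
have [q <-] := mpoly_of_poly_surj g => Ng; apply/vanish2P.
have Yy0 : closed_image Z y0 by exact: closed_image_init.
have [t1 [t2 [t1e t12 t2e f12]]] : exists t1 t2, [/\ t0 - e < t1, t1 < t2,
    t2 < t0 + e & (fiber_poly y0 f).[t1] * (fiber_poly y0 f).[t2] < 0].
  apply: simple_root_sign_change => //; first exact: Zf.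
  by rewrite /fiber_poly deriv_map.
pose c t := f.[mpoly.mpolyC m t].
have nN2 : nbhs y0 [set y | N1 y /\
    (peval (c t1 * c t2) y < 0 /\ peval (lead_coef f) y != 0)].
  apply: filterI => //; apply: filterI; last exact: near_peval_neq0.
  by apply: near_peval_lt0; rewrite pevalM -!horner_fiber_poly.
pose U y t := [/\ closed_image Z y, N1 y, peval (lead_coef f) y != 0,
  `|t - t0| < e & (fiber_poly y f).[t] = 0].
(* Roots of f over good points y near y0 are on Z. *)
have ZU y t : U y t -> Z (join_row y t).
  move=> [Yy N1y ly te ft]; apply: join_row_closed => // q' Zq'.
  have nr : coefs_vanish Z (q' %% f).
    apply: (min_coefs_vanish min_f); last first.
      rewrite ltn_modp; apply/eqP => f0; apply: lf => z _.
      by rewrite f0 lead_coef0 peval0.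
    move=> v Zv; have -> : q' %% f = lead_coef f ^+ scalp q' f *: q' - q' %/ f * f.
      by rewrite Pdiv.Idomain.divp_eq addrAC subrr add0r.
    rewrite fiber_polyB fiber_polyZ fiber_polyM hornerD hornerN hornerZ hornerM.
    by rewrite Zq' // Zf // !mulr0 subr0.
  have := congr1 (fun p => (fiber_poly y p).[t]) (Pdiv.Idomain.divp_eq q' f).
  rewrite fiber_polyZ hornerZ.
  have -> : fiber_poly y (q' %/ f * f + q' %% f) =
      fiber_poly y (q' %/ f) * fiber_poly y f + fiber_poly y (q' %% f).
    by rewrite -fiber_polyM; exact: rmorphD.
  rewrite (coefs_vanish_fiber nr Yy) addr0 hornerM ft mulr0 => /eqP.
  rewrite mulf_eq0 => /orP[|/eqP//].
  have -> : peval (lead_coef f ^+ scalp q' f) y = peval (lead_coef f) y ^+ scalp q' f.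
    exact: rmorphXn.
  by rewrite expf_eq0 (negbTE ly) andbF.
apply: (vanish_sheet irrZ Zf lf min_f (U := U)).
- by move=> y t [].
- move=> d Ud; apply: cen Yy0 dy0 nN2 _ => y [Yy [N1y [f12y ly]]].
  have [|t [t1t tt2 ft]] := poly_ivt_sign (p := fiber_poly y f) t12.
    by move: f12y; rewrite pevalM !horner_fiber_poly.
  apply: (Ud y t); split=> //; rewrite ltr_norml; apply/andP; split; lra.
- move=> y t Uyt; have := Uyt => -[Yy N1y _ te _].
  have := Ng _ (conj (ZU _ _ Uyt) (N1e y t N1y te)).
  by rewrite peval_mpoly_of_poly join_rowK join_row_max.
Qed.

(** The derivative is shorter than [f], so it could vanish on [Z] only if its
    lead coefficient, a nonzero multiple of that of [f], vanished on the closed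
    image. *)
Lemma deriv_not_vanish m (Z : set 'rV[R]_m.+1) f : closed_irreducible Z ->
  vanish2 Z f -> ~ vanish_on (closed_image Z) (lead_coef f) ->
  (forall q, vanish2 Z q -> ~ vanish_on (closed_image Z) (lead_coef q) ->
     (size f <= size q)%N) -> ~ vanish2 Z f^`().
Proof.
move=> irrZ Zf lf min_f Zf'; apply: lf => y Yy.
have [sf|sf] := leqP (size f) 1.
  move: y Yy; apply/vanish_closed_image => v Zv; have := Zf v Zv.
  rewrite (size1_polyC sf) lead_coefC fiber_polyC hornerC.
  by rewrite peval_mwiden.
have f0 : f != 0 by rewrite -size_poly_gt0 (ltn_trans _ sf).
have := min_coefs_vanish min_f Zf' (lt_size_deriv f0) (size f).-2 Yy.
rewrite coef_deriv; have -> : (size f).-2.+1 = (size f).-1.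
  by case: (size f) sf => [|[|]].
have -> : peval (f`_(size f).-1 *+ (size f).-1) y =
    peval (f`_(size f).-1) y *+ (size f).-1 by exact: mpoly.mevalMn.
move=> /eqP; rewrite mulrn_eq0 => /orP[|/eqP//].
by case: (size f) sf => [|[|]].
Qed.

Theorem central_points m (Z : set 'rV[R]_m) : closed_irreducible Z ->
  exists delta, ~ vanish_on Z delta /\ central_off Z delta.
Proof.
elim: m Z => [|m IH] Z irrZ.
  have [_ Z1 _] := irrZ; exists 1; split=> // a N g Za _ /nbhs_singleton Na Zg v Zv.
  by have -> : v = a by [apply/rowP => -[]]; apply: Zg.
have irrY := closed_image_irreducible irrZ.
have [delta [Ydelta cen]] := IH _ irrY.
have [allneg|] := pselect (forall q, vanish2 Z q -> coefs_vanish Z q).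
  exists (mpoly.mwiden delta); split; last exact: central_cylinder.
  by move=> /vanish_closed_image.
move=> /existsNP[q /not_implyP[Zq nq]].
have [|f0 [Zf0 lf0 _]] := strip (P := vanish2 Z) _ Zq nq.
  move=> q1 d Zq1 nd v Zv; rewrite fiber_polyB hornerD hornerN Zq1 //.
  by rewrite (coefs_vanish_fiber nd (closed_image_init Zv)) horner0 oppr0 addr0.
have [|f [[Zf lf] min_f']] := @minimal_size _ (fun f => vanish2 Z f /\
  ~ vanish_on (closed_image Z) (lead_coef f)); first by exists f0.
have min_f q' : vanish2 Z q' -> ~ vanish_on (closed_image Z) (lead_coef q') ->
  (size f <= size q')%N by move=> Zq' lq'; apply: min_f'.
exists (mpoly_of_poly (delta%:P * (lead_coef f)%:P * f^`())); split.
  have constY c : vanish2 Z c%:P -> vanish_on (closed_image Z) c.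
    move=> Zc; apply/vanish_closed_image => v Zv; have := Zc v Zv.
    by rewrite fiber_polyC hornerC peval_mwiden.
  move=> /vanish2P/(vanish2M irrZ)[/(vanish2M irrZ)[/constY//|/constY//]|].
  exact: deriv_not_vanish.
exact: central_sheet.
Qed.

End CentralPoints.

(** * Irreducible pieces of varieties *)

Section IrreduciblePieces.
Variables (R : realType) (V : affineVariety R).
Implicit Types (A C O S U X Z : set V).

Lemma vanish_image A p : vanish A p <-> vanish_on (@av_emb R V @` A) p.
Proof. by split=> [Ap _ [x Ax <-]|Ap x Ax]; [exact: Ap|apply: Ap; exists x]. Qed.

Definition zariski_irreducible Z : Prop :=
  [/\ zariski_closed Z, ~ vanish Z 1 &
      forall p q, vanish Z (p * q) -> vanish Z p \/ vanish Z q].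

Lemma closed_irreducible_image Z :
  zariski_irreducible Z -> closed_irreducible (@av_emb R V @` Z).
Proof.
move=> [clZ Z1 prZ]; split.
- move=> v vZ; have [P VP] := av_emb_alg V.
  have : range (@av_emb R V) v.
    rewrite VP => p Pp; apply: vZ => _ [x _ <-].
    have : range (@av_emb R V) (av_emb x) by exists x.
    by rewrite VP; exact.
  move=> [x _ xv]; exists x => //; apply: ((zariski_closedP Z).1 clZ) => p Zp.
  by rewrite xv; apply: vZ; exact/vanish_image.
- by move=> /vanish_image.
- by move=> p q /vanish_image/prZ[] /vanish_image; [left|right].
Qed.

Lemma zariski_open_separate U x : zariski_open U -> U x ->
  exists2 p, peval p (av_emb x) != 0 & forall y, ~ U y -> peval p (av_emb y) = 0.
Proof.
move=> /zariski_closedP clU Ux; apply: contrapT => np; apply: (clU x _ Ux) => p pU.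
by apply: contrapT => /eqP px; apply: np; exists p => // y nU; exact: pU.
Qed.

Lemma irreducible_meet Z O O' : zariski_irreducible Z -> zariski_open O ->
  zariski_open O' -> Z `&` O !=set0 -> Z `&` O' !=set0 ->
  Z `&` (O `&` O') !=set0.
Proof.
move=> [_ _ prZ] opO opO' [x [Zx Ox]] [x' [Zx' O'x']].
have [p px pO] := zariski_open_separate opO Ox.
have [q qx qO] := zariski_open_separate opO' O'x'.
apply: contrapT => none.
have /prZ[Zp|Zq] : vanish Z (p * q).
  move=> y Zy; rewrite pevalM; have [Oy|/pO ->] := pselect (O y); last exact: mul0r.
  have [ O'y|/qO ->] := pselect (O' y); last exact: mulr0.
  by case: none; exists y.
- by move: px; rewrite Zp ?eqxx.
- by move: qx; rewrite Zq ?eqxx.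
Qed.

(** Take [Z1] minimal among the closed sets that contain a nonempty relatively
    open part of [Z]. *)
Lemma irreducible_piece Z : zariski_closed Z -> Z !=set0 ->
  exists Z1 O1, [/\ zariski_irreducible Z1, zariski_open O1,
    Z1 `&` O1 !=set0 & Z `&` O1 = Z1 `&` O1].
Proof.
move=> clZ Z0.
pose P D := zariski_closed D /\ exists O,
  [/\ zariski_open O, Z `&` O !=set0 & Z `&` O `<=` D].
have [|//|Z1 [[clZ1 [ O1 [opO1 ZO1 ZO1s]]] minZ1]] := zariski_minimal (P := P).
- by move=> C [].
- exists Z; split=> //; exists setT; rewrite setIT.
  by split=> //; exact: zariski_openT.
have Z1Z : Z1 `<=` Z.
  suff ZZ1 : Z `&` Z1 = Z1 by rewrite -ZZ1 => x [].
  apply: minZ1; last by move=> x [].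
  split; first exact: zariski_closedI.
  by exists O1; split=> // x ZOx; split; [case: ZOx|exact: ZO1s].
have ZE : Z `&` O1 = Z1 `&` O1.
  apply/seteqP; split=> x [Zx O1x]; split=> //; last exact: Z1Z.
  exact: ZO1s.
exists Z1, O1; rewrite -ZE; split=> //; split=> //.
  by have [x /ZO1s Z1x] := ZO1 => /(_ x Z1x)/eqP; rewrite peval1 oner_eq0.
move=> p q Zpq; have [Zp|nZp] := pselect (vanish Z1 p); [by left|right].
have [x [ZO1x px]] : exists x, (Z `&` O1) x /\ peval p (av_emb x) != 0.
  apply: contrapT => none; apply: nZp.
  suff Z1p : Z1 = Z1 `&` [set x | peval p (av_emb x) = 0].
    by rewrite Z1p => x [].
  apply/esym/minZ1; last by move=> x [].
  split; first by apply: zariski_closedI => //; exact: zariski_closed_zero.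
  exists O1; split=> // x ZOx; split; first exact: ZO1s.
  by apply: contrapT => /eqP px; apply: none; exists x.
suff Z1q : Z1 = Z1 `&` [set x | peval q (av_emb x) = 0].
  by rewrite Z1q => y [].
apply/esym/minZ1; last by move=> y [].
split; first by apply: zariski_closedI => //; exact: zariski_closed_zero.
exists (O1 `&` [set y | peval p (av_emb y) != 0]); split.
- by apply: zariski_openI => //; exact: zariski_open_nonzero.
- by exists x; case: ZO1x.
- move=> y [Zy [ O1y py]]; have Z1y : Z1 y by exact: ZO1s.
  split=> //; have /eqP := Zpq y Z1y.
  by rewrite pevalM mulf_eq0 (negbTE py) => /eqP.
Qed.

Definition dense_in Z A : Prop := forall p, vanish (A `&` Z) p -> vanish Z p.

(** If no stratum is dense, the product of polynomials vanishing on the traces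
    of the strata, but not on [Z], contradicts irreducibility. *)
Lemma dense_stratum Z (SS : set (set V)) : zariski_irreducible Z ->
  finite_set SS -> (forall S, SS S -> zariski_locally_closed S) ->
  dense_in Z (\bigcup_(S in SS) S) ->
  exists S O, [/\ SS S, zariski_open O, Z `&` O !=set0 & Z `&` O `<=` S].
Proof.
move=> [clZ Z1 prZ] /finite_seqP[s ->] lcS dense.
have [S [Ss dS]] : exists S, S \in s /\ dense_in Z S.
  apply: contrapT => none; elim: s {lcS} dense none => [|S s IH] dense none.
    by apply: Z1; apply: dense; rewrite set_nil bigcup_set0 set0I.
  have [p Sp nZp] : exists2 p, vanish (S `&` Z) p & ~ vanish Z p.
    apply: contrapT => np; apply: none; exists S; rewrite mem_head; split=> // p Sp.
    by apply: contrapT => nZp; apply: np; exists p.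
  apply: IH => [q sq|[T [Ts dT]]]; last first.
    by apply: none; exists T; rewrite inE Ts orbT.
  have /prZ[|//] : vanish Z (p * q); last by move/nZp.
  apply: dense => x [[T /= + Tx] Zx]; rewrite inE pevalM => /orP[/eqP TS|Ts].
    by rewrite Sp ?mul0r // -TS.
  by rewrite sq ?mulr0 //; split=> //; exists T.
have [C [ O [clC opO SE]]] := lcS S Ss.
have ZC : Z `<=` C.
  move=> x Zx; apply: ((zariski_closedP C).1 clC) => p Cp; apply: dS Zx => y [+ _].
  by rewrite SE => -[/Cp].
exists S, O; split=> //; last by move=> x [/ZC Cx Ox]; rewrite SE.
apply: contrapT => nZO; apply: Z1; apply: dS => x [+ Zx].
by rewrite SE => -[_ Ox]; case: nZO; exists x.
Qed.

End IrreduciblePieces.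

(** * Regulous and stratified-algebraic bundles *)

Section Main.
Variables (R : realType) (V : affineVariety R) (F : scalar_kind) (n : nat).
Implicit Types (A C O S U X Z : set V) (E : set (prod_variety V F n)).

Lemma restr_fiber E S x : S x -> fiber (restr E S) x = fiber E x.
Proof.
by move=> Sx; apply/seteqP; split=> w; [case|move=> Ew; split].
Qed.

Lemma restr_bundle_proj E S x : S x ->
  bundle_proj (restr E S) x = bundle_proj E x.
Proof. by move=> Sx; rewrite /bundle_proj restr_fiber. Qed.

Lemma proj_algebraic E S :
  (forall x, S x -> vector_subspace (fiber E x)) ->
  (forall x, S x -> orth_proj (fiber E x) (bundle_proj E x)) ->
  (forall x, S x -> exists r f g, @linear_chart R F n r (fiber E x) f g) ->
  mx_class (regular_on S) (bundle_proj E) ->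
  algebraic_subbundle S (restr E S).
Proof.
move=> sE oE chE KE; have geo := regular_geometry R.
have KE' : mx_class (regular_on S) (bundle_proj (restr E S)).
  apply: (mx_class_ext (function_class_regular S)) KE => x Sx.
  by rewrite restr_bundle_proj.
have oE' x : S x -> orth_proj (fiber (restr E S) x) (bundle_proj (restr E S) x).
  by move=> Sx; rewrite restr_bundle_proj // restr_fiber //; exact: oE.
split.
  have [f Kf fE] := bundle_equation geo I KE' oE'.
  have [C clC fC] := regular_on_zero Kf; exists C => //; rewrite -fC.
  apply/seteqP; split=> z; first by move=> Ez; have [_ Sz] := Ez; split=> //; exact/fE.
  by move=> [Sz]; exact: (fE z Sz).2.
apply: (proj_locally_trivial geo) => // x Sx; rewrite restr_fiber //.
  exact: sE.
exact: chE.
Qed.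

Lemma constructible_dense_open Z A : zariski_irreducible Z -> constructible A ->
  dense_in Z A -> exists O, [/\ zariski_open O, Z `&` O !=set0 & Z `&` O `<=` A].
Proof.
move=> irrZ [SS [finS lcS ->]] /(dense_stratum irrZ finS lcS).
move=> [S [ O [SS_S opO ZO ZOS]]]; exists O; split=> // x /ZOS Sx.
by exists S.
Qed.

(** The conclusion of [central_points], with Euclidean neighborhoods described
    as complements of closed sets [C]. *)
Lemma irreducible_central Z : zariski_irreducible Z ->
  exists O, [/\ zariski_open O, Z `&` O !=set0 & forall x C p, Z x -> O x ->
    euclidean_closed C -> ~ C x -> vanish (Z `&` ~` C) p -> vanish Z p].
Proof.
move=> irrZ; have [delta [Zd cen]] := central_points (closed_irreducible_image irrZ).
exists [set x | peval delta (av_emb x) != 0]; split.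
- exact: zariski_open_nonzero.
- apply: contrapT => none; apply: Zd; apply/vanish_image => x Zx.
  by apply: contrapT => /eqP dx; apply: none; exists x.
- move=> x C p Zx dx /closed_openC [W opW WC] nCx Cp; apply/vanish_image.
  apply: (cen (av_emb x) W) => //.
    apply: open_nbhs_nbhs; split=> //.
    by have : (@av_emb R V @^-1` W) x by rewrite WC.
  move=> _ [[y Zy <-] Wy]; apply: Cp; split=> //.
  by rewrite -WC.
Qed.

Lemma regulous_subbundle_locally_closed X E : constructible_closed X ->
  regulous_subbundle X E -> constructible_locally_closed E.
Proof.
move=> clX [[C clC ->] _]; apply: constructible_closed_locally_closed.
by apply: constructible_closedI => //; exact: constructible_closed_prod.
Qed.

(** At a central point [x0] of [Z] in [X], the neighborhood [U] of [x0] over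
    which the bundle is trivial is dense in [Z].  The projector is regulous on
    [U], hence regular on some stratum that contains a nonempty open part of
    [Z]. *)
Lemma regulous_generically_algebraic X E Z O1 : constructible_closed X ->
  regulous_subbundle X E -> zariski_irreducible Z -> dense_in Z X ->
  (forall x, X x -> vector_subspace (fiber E x)) ->
  zariski_open O1 -> Z `&` O1 !=set0 ->
  exists O, [/\ zariski_open O, Z `&` O !=set0, O `<=` O1, Z `&` O `<=` X &
    algebraic_subbundle (Z `&` O) (restr E (Z `&` O))].
Proof.
move=> clX regE irrZ dX sE opO1 ZO1.
have [ OX [opOX ZOX OXX]] := constructible_dense_open irrZ clX.2 dX.
have [ Oc [opOc ZOc cen]] := irreducible_central irrZ.
have [x0 [Zx0 [ OXx0 Ocx0]]] := irreducible_meet irrZ opOX opOc ZOX ZOc.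
have lcX := constructible_closed_locally_closed clX.
have lcE := regulous_subbundle_locally_closed clX regE.
have [U [opU Ux0 KU trivU]] :=
  locally_trivial_proj (regulous_geometry R) lcX lcE sE regE.2 (OXX _ (conj Zx0 OXx0)).
have cU := constructible_locally_closed_constructible
  (constructible_locally_closed_open_in lcX opU).
have [W opW UW] := opU.
have UX : U `<=` X by rewrite UW => x [].
(* A polynomial s that vanishes outside OX but not at x0 turns a polynomial
   vanishing on U into one vanishing on Z near x0. *)
have dU : dense_in Z U.
  have [_ _ prZ] := irrZ; move=> p Up.
  have [s sx0 sO] := zariski_open_separate opOX OXx0.
  have /prZ[//|Zs] : vanish Z (p * s); last by move: sx0; rewrite Zs ?eqxx.
  apply: (cen x0 (~` W)) => //; first exact: opW.1.
    by move: Ux0; rewrite UW => -[_ Wx0]; apply.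
  move=> y [Zy /contrapT Wy]; rewrite pevalM.
  have [OXy|/sO ->] := pselect (OX y); last exact: mulr0.
  by rewrite Up ?mul0r //; split=> //; rewrite UW; split=> //; exact: OXX.
have [SS [finS lcS trS SE] rSS] := regulous_on_common cU
  (f := fun (ij : 'I__ * 'I__) x => bundle_proj E x ij.1 ij.2)
  (fun ij => KU ij.1 ij.2).
have [|S [ O2 [SS_S opO2 ZO2 ZO2S]]] := dense_stratum irrZ finS lcS.
  by rewrite SE.
pose O := O2 `&` O1; have opO : zariski_open O by exact: zariski_openI.
have ZO : Z `&` O !=set0 by exact: irreducible_meet.
have ZOS : Z `&` O `<=` S by move=> x [Zx [ O2x _]]; exact: ZO2S.
have ZOU : Z `&` O `<=` U by move=> x /ZOS Sx; rewrite -SE; exists S.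
exists O; split=> //; [by move=> x []|by move=> x /ZOU/UX|].
apply: proj_algebraic.
- by move=> x /ZOU/UX; exact: sE.
- by move=> x /ZOU/trivU[].
- by move=> x /ZOU/trivU[].
- by move=> i j; apply: regular_onS ZOS _; exact: (rSS (i, j)).2.
Qed.

Definition algebraic_stratification E A : Prop :=
  exists2 SS, stratification A SS &
    forall S, SS S -> algebraic_subbundle S (restr E S).

Lemma algebraic_stratificationU E A B : algebraic_stratification E A ->
  algebraic_stratification E B -> A `&` B = set0 ->
  algebraic_stratification E (A `|` B).
Proof.
move=> [SS stA algS] [TT stB algT] AB0; exists (SS `|` TT).
  exact: stratificationU.
by move=> S [/algS|/algT].
Qed.

(** A minimal closed [Z] for which the part of [X] in [Z] has no algebraic
    stratification would lose a nonempty open part: one over which the bundle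
    is algebraic, or one which does not meet [X]. *)
Lemma regulous_algebraic_stratification X E : constructible_closed X ->
  (forall x, X x -> vector_subspace (fiber E x)) ->
  regulous_subbundle X E -> algebraic_stratification E X.
Proof.
move=> clX sE regE; apply: contrapT => nX.
have strat0 : algebraic_stratification E set0.
  by exists set0 => //; split=> //; rewrite bigcup_set0.
have [||Z [[clZ nZ] minZ]] := @zariski_minimal R V
    (fun D => zariski_closed D /\ ~ algebraic_stratification E (X `&` D)).
- by move=> C [].
- by exists setT; rewrite setIT; split=> //; exact: zariski_closedT.
have Z0 : Z !=set0.
  by apply/set0P/eqP => Z0; apply: nZ; rewrite Z0 setI0.
have [Z1 [ O1 [irrZ1 opO1 Z1O1 ZO1]]] := irreducible_piece clZ Z0.
have [ O [opO ZO stZO]] : exists O, [/\ zariski_open O, Z `&` O !=set0 &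
    algebraic_stratification E (X `&` (Z `&` O))].
  have [dX|] := pselect (dense_in Z1 X).
    have [ O [opO Z1O OO1 Z1OX algO]] :=
      regulous_generically_algebraic clX regE irrZ1 dX sE opO1 Z1O1.
    have ZO : Z `&` O = Z1 `&` O.
      by rewrite -(setIidr OO1) !setIA ZO1.
    exists O; split=> //; rewrite ZO //.
    rewrite (setIidr Z1OX); exists [set Z1 `&` O]; last by move=> _ ->.
    split.
    + exact: finite_set1.
    + move=> _ ->; apply: locally_closedI.
        by apply: zariski_closed_locally_closed; case: irrZ1.
      exact: zariski_open_locally_closed.
    + by move=> _ _ -> ->.
    + by rewrite bigcup_set1.
  move=> /existsNP[p /not_implyP[Xp nZp]].
  exists (O1 `&` [set x | peval p (av_emb x) != 0]); split.
  - by apply: zariski_openI => //; exact: zariski_open_nonzero.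
  - rewrite setIA ZO1 -setIA; apply: irreducible_meet => //.
      exact: zariski_open_nonzero.
    apply: contrapT => none; apply: nZp => x Z1x; apply: contrapT => /eqP px.
    by apply: none; exists x.
  - have -> // : X `&` (Z `&` (O1 `&` [set x | peval p (av_emb x) != 0])) = set0.
    rewrite [Z `&` _]setIA ZO1; apply/seteqP; split=> // x [Xx [[Z1x _]]] /=.
    by rewrite Xp ?eqxx.
have [ZnO_closed ZnO_sub] : zariski_closed (Z `&` ~` O) /\ Z `&` ~` O `<=` Z.
  by split; [exact: zariski_closedI|move=> x []].
have stZnO : algebraic_stratification E (X `&` (Z `&` ~` O)).
  apply: contrapT => nst; have [x [Zx Ox]] := ZO.
  have ZE : Z `&` ~` O = Z by exact: minZ.
  by move: Zx; rewrite -ZE => -[_ /(_ Ox)].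
apply: nZ; have -> : X `&` Z = (X `&` (Z `&` O)) `|` (X `&` (Z `&` ~` O)).
  by rewrite -!setIUr setUCr setIT.
apply: algebraic_stratificationU => //.
by apply/seteqP; split=> // x [[_ [_ Ox]] [_ [_ nOx]]]; exact: nOx.
Qed.

Lemma regulous_topological X E : constructible_closed X ->
  regulous_subbundle X E ->
  topological_subbundle X E.
Proof.
move=> clX regE x Xx.
have geo := regulous_geometry R; have geoc := continuous_geometry R.
have lcX := constructible_closed_locally_closed clX.
have lcE := regulous_subbundle_locally_closed clX regE.
have [U [opU Ux [r [h [iso_h lin_h]]]]] := regE.2 x Xx.
have lcU : constructible_locally_closed U by exact: (geo_open geo) opU.
have gEU : constructible_locally_closed (restr E U).
  by apply: (geo_I geo) => //; exact: (geo_prod geo).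
have gP : constructible_locally_closed (prod_over F r U) by exact: (geo_prod geo).
have to_cont (W W' : affineVariety R) (A : set W) (B : set W') g :
    constructible_locally_closed A -> constructible_locally_closed B ->
    regulous_map A B g -> continuous_map A B g.
  move=> gA gB /(geo_mor geo _ gA gB)[AB Kg].
  by apply/(geo_mor geoc) => //; split=> // i j; case: (Kg i j).
exists U; split=> //.
  have [ O [clO _] ->] := opU; exists O => //.
  by rewrite /euclidean_open -(setCK O); exact: closed_openC.
exists r, h; split=> //; have [k [mor_h mor_k kh hk]] := iso_h.
by exists k; split=> //; exact: to_cont.
Qed.

(** The projector does not depend on trivializations, so that its continuity on
    [X] and its regularity on the strata, each obtained from trivializations of
    its own kind, combine. *)
Lemma topological_algebraic_regulous X E : constructible_closed X ->
  E `<=` prod_over F n X ->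
  (forall x, X x -> vector_subspace (fiber E x)) ->
  topological_subbundle X E -> algebraic_stratification E X ->
  regulous_subbundle X E.
Proof.
move=> clX EX sE topE [SS stX algE].
have geo := regulous_geometry R.
have loc := locally_trivial_proj (continuous_geometry R) I I sE topE.
have oE x : X x -> orth_proj (fiber E x) (bundle_proj E x).
  by move=> Xx; have [U [_ Ux _ /(_ x Ux)[]]] := loc x Xx.
have contE : mx_class (cont_on X) (bundle_proj E).
  move=> i j; apply: (within_continuous_local (T := euclidean V)) => x Xx.
  have [U [[ O opO UE] Ux KU _]] := loc x Xx; exists O; rewrite -UE; split=> //.
    by move: Ux; rewrite UE => -[].
  exact: KU.
have regE : mx_class (strat_regular SS) (bundle_proj E).
  move=> i j S SS_S; apply: regular_on_local => x Sx.
  have sS y : S y -> vector_subspace (fiber (restr E S) y).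
    by move=> Sy; rewrite restr_fiber //; apply: sE; exact: stratum_sub stX SS_S _ Sy.
  have [U [[ O opO UE] Ux KU _]] :=
    locally_trivial_proj (regular_geometry R) I I sS (algE S SS_S).2 Sx.
  exists O; rewrite -UE; split=> //; first by move: Ux; rewrite UE => -[].
  apply: (fc_ext (function_class_regular U)) (KU i j) => y.
  by rewrite UE => -[Sy _]; rewrite restr_bundle_proj.
have KE : mx_class (regulous_on X) (bundle_proj E).
  by move=> i j; apply: (regulous_on_stratified stX); split; [exact: contE|exact: regE].
have lcX := constructible_closed_locally_closed clX.
have clE : constructible_closed E.
  have [f Kf fE] := bundle_equation geo lcX KE oE.
  have -> : E = prod_over F n X `&` [set z | f z = 0].
    apply/seteqP; split=> z; first by move=> Ez; split; [exact: EX|exact/fE/Ez/EX].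
    by move=> [Xz] /(fE z Xz).
  by apply: constructible_closed_zero => //; exact: constructible_closed_prod.
split; first by exists E => //; rewrite (setIidr EX).
apply: (proj_locally_trivial geo) => //.
  exact: constructible_closed_locally_closed.
by move=> x Xx; have [U [_ Ux _ /(_ x Ux)[]]] := loc x Xx.
Qed.

End Main.

Theorem mainTheorem2 (R : realType) (F : scalar_kind) (V : affineVariety R)
    (X : set V) (n : nat) (E : set (prod_variety V F n))
    (hX : constructible_closed X)
    (hE : E `<=` prod_over F n X)
    (hEx : forall x, X x -> vector_subspace (fiber E x)) :
  regulous_subbundle X E <->
  (topological_subbundle X E /\
   exists2 SS : set (set V), stratification X SS &
     forall S, SS S -> algebraic_subbundle S (restr E S)).
Proof.
split=> [regE|[topE algE]]; last exact: topological_algebraic_regulous.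
by split; [exact: regulous_topological|exact: regulous_algebraic_stratification].
Qed.
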